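(* For every finite group $G$ and every homomorphism $\theta : G \to G$, the generalized Thompson group $V_{(G,\theta)}$ is co$\mathcal{CF}$; that is, it is finitely generated and its co-word problem with respect to some (equivalently, any) finite monoid generating set is a context-free language.
   Context: Word problems. A finite monoid generating set of a group $K$ is a finite alphabet $\Sigma$ together with a surjective monoid homomorphism $\Phi : \Sigma^* \to K$ from the free monoid on $\Sigma$. The word problem of $K$ with respect to $\Sigma$ is $\{w \in \Sigma^* : \Phi(w) = 1\}$, and the co-word problem is its complement in $\Sigma^*$. A finitely generated group is co$\mathcal{CF}$ if its co-word problem with respect to some finite monoid generating set is a context-free language; this property does not depend on the choice of finite monoid generating set. A language is context-free if it is accepted by a (nondeterministic) pushdown automaton. The group $V_{(G,\theta)}$. Let $G$ be a finite group and $\theta : G\to G$ a homomorphism. Identify a finite rooted binary tree with its set of leaves, i.e. with a finite set $\{u_1,\dots,u_n\}$ of finite binary words such that every infinite binary string has exactly one $u_i$ as a prefix. A labelled tree pair $(a,b)$ consists of a range tree $a$ with leaves $v_1,\dots,v_n$ and a domain tree $b$ with leaves $u_1,\dots,u_n$ (the same number of leaves, in any order), a bijection between leaves sending $u_i$ to $v_i$, and an element of $G$ attached to each leaf of each tree. Write it as a finite set of rows $(u_i,k_i)\mapsto(v_i,g_i)$, $1 \le i \le n$, with $k_i, g_i\in G$ (label $1_G$ means no group element is attached). Consider the equivalence relation on labelled tree pairs generated by the following two moves. (1) Adding canceling carets: replace a row $(u_i,k_i)\mapsto(v_i,g_i)$ by the two rows $(u_i0,k_i)\mapsto(v_i0,g_i)$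 and $(u_i1,\theta(k_i))\mapsto(v_i1,\theta(g_i))$. (2) Adding canceling group elements: replace a row $(u_i,k_i)\mapsto(v_i,g_i)$ by $(u_i,k_ih)\mapsto(v_i,g_ih)$ for some $h\in G$. The elements of $V_{(G,\theta)}$ are the equivalence classes. To multiply the classes of $(a,b)$ and $(c,d)$, choose equivalent labelled tree pairs $(a',b')$ and $(c',d')$ with $b'=c'$ as labelled trees, and set $(a,b)(c,d)=(a',b')(c',d')=(a',d')$: rows $(u,l)\mapsto(w,k)$ of $(c',d')$ and $(w,k)\mapsto(v,g)$ of $(a',b')$ give the row $(u,l)\mapsto(v,g)$ of the product. This is a well-defined group operation. For $G$ trivial, this group is Thompson's group $V$. *)

(* Defs.v *)
From HB Require Import structures.
From Stdlib Require Import Relation_Operators.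
From mathcomp Require Import all_boot all_fingroup finmap.
From mathcomp Require Import boolp.

Set Implicit Arguments.
Unset Strict Implicit.
Unset Printing Implicit Defensive.

(* A transition [(q, a, Z, (q', s))] may be taken in state [q] with [Z] on top
   of the stack; it reads the letter [c] if [a = Some c] and nothing if
   [a = None], pops [Z] and pushes the string [s]. *)
Record pda (Sigma : finType) := Pda {
  pda_state : finType;
  pda_stack : finType;
  pda_start : pda_state;
  pda_bottom : pda_stack;
  pda_final : {set pda_state};
  pda_trans : seq (pda_state * option Sigma * pda_stack *
                   (pda_state * seq pda_stack))
}.

Section Pda.
Variables (Sigma : finType) (M : pda Sigma).

(* State, remaining input, stack (top first). *)
Definition pda_config := (pda_state M * seq Sigma * seq (pda_stack M))%type.

Inductive pda_step : pda_config -> pda_config -> Prop :=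
| PdaRead q c Z q' s w t :
    (q, Some c, Z, (q', s)) \in pda_trans M ->
    pda_step (q, c :: w, Z :: t) (q', w, s ++ t)
| PdaEps q Z q' s w t :
    (q, None, Z, (q', s)) \in pda_trans M ->
    pda_step (q, w, Z :: t) (q', w, s ++ t).

Definition pda_accepts (w : seq Sigma) : Prop :=
  exists q t, q \in pda_final M /\
    clos_refl_trans _ pda_step
      (pda_start M, w, [:: pda_bottom M]) (q, [::], t).

End Pda.

Definition context_free (Sigma : finType) (L : seq Sigma -> Prop) : Prop :=
  exists M : pda Sigma, forall w, L w <-> pda_accepts M w.

Section CoCF.
Variable K : groupType.
Local Open Scope group_scope.

Definition monoid_generating_set (Sigma : finType) (Phi : seq Sigma -> K) :=
  [/\ Phi [::] = 1,
      forall v w, Phi (v ++ w) = Phi v * Phi w &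
      forall x, exists w, Phi w = x].

Definition word_problem (Sigma : finType) (Phi : seq Sigma -> K)
  (w : seq Sigma) : Prop := Phi w = 1.

Definition coword_problem (Sigma : finType) (Phi : seq Sigma -> K)
  (w : seq Sigma) : Prop := ~ word_problem Phi w.

Definition coCF : Prop :=
  exists (Sigma : finType) (Phi : seq Sigma -> K),
    monoid_generating_set Phi /\ context_free (coword_problem Phi).

End CoCF.

Section GeneralizedThompson.
Variables (gT : finGroupType) (theta : {morphism [set: gT] >-> gT}).
Local Open Scope fset_scope.
Local Open Scope group_scope.

Definition is_prefix (u : seq bool) (x : nat -> bool) : Prop :=
  mkseq x (size u) = u.

Definition is_tree (A : {fset seq bool}) : Prop :=
  forall x : nat -> bool, exists! u, u \in A /\ is_prefix u x.

Local Notation leaf := (seq bool * gT)%type.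
Local Notation row := (leaf * leaf)%type.

(* The row [(u, k) |-> (v, g)] is [((u, k), (v, g))]. *)
Definition dom_word (r : row) : seq bool := r.1.1.
Definition ran_word (r : row) : seq bool := r.2.1.

Definition is_tree_pair (p : {fset row}) : Prop :=
  [/\ {in p &, injective dom_word}, is_tree [fset dom_word r | r in p],
      {in p &, injective ran_word} & is_tree [fset ran_word r | r in p]].

Record tree_pair := TreePair {
  rows :> {fset row};
  _ : `[< is_tree_pair rows >]
}.

HB.instance Definition _ := [isSub for rows].
HB.instance Definition _ := [Choice of tree_pair by <:].

Definition dom_tree (p : {fset row}) : {fset leaf} := [fset r.1 | r in p].
Definition ran_tree (p : {fset row}) : {fset leaf} := [fset r.2 | r in p].

Definition caret_row (b : bool) (r : row) : row :=
  let l g := if b then theta g else g in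
  ((rcons r.1.1 b, l r.1.2), (rcons r.2.1 b, l r.2.2)).

Definition label_row (h : gT) (r : row) : row :=
  ((r.1.1, r.1.2 * h), (r.2.1, r.2.2 * h)).

Definition add_carets (p q : {fset row}) : Prop :=
  exists2 r, r \in p &
    q = caret_row false r |` (caret_row true r |` (p `\ r)).

Definition add_labels (p q : {fset row}) : Prop :=
  exists r h, r \in p /\ q = label_row h r |` (p `\ r).

Definition tp_equiv : tree_pair -> tree_pair -> Prop :=
  clos_refl_sym_trans tree_pair (fun p q => add_carets p q \/ add_labels p q).

(* The rows of the product [(a, b)(b, d)] of [p = (a, b)] and [q = (b, d)]:
   [q] acts first. *)
Definition comp_rows (p q : {fset row}) : {fset row} :=
  [fset (s.1, r.2) | s in q, r in p & s.2 == r.1].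

Definition tp_equivb (p q : tree_pair) : bool := `[< tp_equiv p q >].

Lemma tp_equivb_refl : reflexive tp_equivb.
Proof. by move=> p; apply/asboolP; apply: rst_refl. Qed.

Lemma tp_equivb_sym : symmetric tp_equivb.
Proof. by move=> p q; apply/asboolP/asboolP; apply: rst_sym. Qed.

Lemma tp_equivb_trans : transitive tp_equivb.
Proof.
by move=> q p r /asboolP pq /asboolP qr; apply/asboolP; apply: rst_trans pq qr.
Qed.

Canonical tp_equiv_rel :=
  EquivRel tp_equivb tp_equivb_refl tp_equivb_sym tp_equivb_trans.

Definition thompsonV := {eq_quot tp_equiv_rel}%qT.
HB.instance Definition _ := Choice.on thompsonV.

Definition vclass (p : tree_pair) : thompsonV := (\pi_thompsonV p)%qT.

Lemma vclassP p q : vclass p = vclass q <-> tp_equiv p q.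
Proof.
rewrite /vclass; split=> [/eqmodP /asboolP //|pq].
by apply/eqmodP/asboolP.
Qed.

Lemma vclass_surj (x : thompsonV) : exists p, x = vclass p.
Proof. by exists (generic_quotient.repr x); rewrite /vclass reprK. Qed.

Lemma is_prefix_nth u w : is_prefix u (nth false (u ++ w)).
Proof.
apply: (@eq_from_nth _ false) => [|i]; rewrite size_mkseq // => iu.
by rewrite nth_mkseq // nth_cat iu.
Qed.

Lemma prefix_is_prefix u w : prefix u w -> is_prefix u (nth false w).
Proof. by move=> /prefixP[x ->]; apply: is_prefix_nth. Qed.

Lemma is_prefix_prefix u w :
  size u <= size w -> is_prefix u (nth false w) -> prefix u w.
Proof.
move=> uw <-; rewrite prefixE size_mkseq; apply/eqP.
apply: (@eq_from_nth _ false) => [|i]; rewrite size_takel ?size_mkseq // => iu.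
by rewrite nth_mkseq // nth_take.
Qed.

Lemma is_prefix_rcons u b x :
  is_prefix (rcons u b) x <-> is_prefix u x /\ x (size u) = b.
Proof.
rewrite /is_prefix size_rcons mkseqS; split=> [/rcons_inj[-> ->] //|[-> ->] //].
Qed.

Definition covers (f : row -> seq bool) (p : {fset row}) : Prop :=
  forall x, exists! r, r \in p /\ is_prefix (f r) x.

Lemma coverP f p :
  {in p &, injective f} /\ is_tree [fset f r | r in p] <-> covers f p.
Proof.
split=> [[finj ft] x|fp].
  have [u [[/imfsetP[r /= rp ->] ux] uniq]] := ft x.
  exists r; split=> // s [sp sx]; apply: finj => //.
  by apply: uniq; split=> //; apply/imfsetP; exists s.
split=> [r s rp sp rs|x].
  have [t [_ tuniq]] := fp (nth false (f r)).
  have rx : is_prefix (f r) (nth false (f r)).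
    by have := is_prefix_nth (f r) [::]; rewrite cats0.
  by rewrite -(tuniq r) // -(tuniq s) // -rs.
have [r [[rp rx] uniq]] := fp x; exists (f r); split.
  by split=> //; apply/imfsetP; exists r.
by move=> u [/imfsetP[s /= sp ->] sx]; rewrite (uniq s).
Qed.

Lemma is_tree_pairP p :
  is_tree_pair p <-> covers dom_word p /\ covers ran_word p.
Proof.
rewrite -!coverP; split=> [[? ? ? ?]|[[? ?] [? ?]]]; last by split.
by split; split.
Qed.

Lemma rowsP (p : tree_pair) : covers dom_word p /\ covers ran_word p.
Proof. by case: p => p /= /asboolP/is_tree_pairP. Qed.

Lemma mk_tree_pair (p : {fset row}) :
  covers dom_word p -> covers ran_word p -> exists q : tree_pair, rows q = p.
Proof.
move=> pd pr; have pv : `[< is_tree_pair p >] by apply/asboolP/is_tree_pairP.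
by exists (TreePair pv).
Qed.

Lemma cover_caret f (p : {fset row}) r r0 r1 : r \in p -> covers f p ->
  f r0 = rcons (f r) false -> f r1 = rcons (f r) true ->
  covers f (r0 |` (r1 |` (p `\ r))).
Proof.
move=> rp fp f0 f1 x; have [s [[sp sx] uniq]] := fp x.
have [sr|sr] := eqVneq s r; last first.
  exists s; split; first by rewrite !inE sr sp !orbT.
  move=> t [+ tx]; rewrite !inE => /or3P[/eqP tE|/eqP tE|/andP[_ tp]].
  - move: tx; rewrite tE f0 => /is_prefix_rcons[rx _].
    by rewrite (uniq r) ?eqxx in sr.
  - move: tx; rewrite tE f1 => /is_prefix_rcons[rx _].
    by rewrite (uniq r) ?eqxx in sr.
  - exact: uniq.
subst s; exists (if x (size (f r)) then r1 else r0); split.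
  split; first by rewrite !inE; case: ifP; rewrite eqxx ?orbT.
  by case: ifP => xb; rewrite ?f0 ?f1; apply/is_prefix_rcons.
move=> t [+ tx]; rewrite !inE => /or3P[/eqP tE|/eqP tE|/andP[tr tp]].
- by move: tx; rewrite tE f0 => /is_prefix_rcons[_ ->].
- by move: tx; rewrite tE f1 => /is_prefix_rcons[_ ->].
- by rewrite (uniq t) ?eqxx in tr.
Qed.

Lemma cover_label f (p : {fset row}) r r' : r \in p -> covers f p ->
  f r' = f r -> covers f (r' |` (p `\ r)).
Proof.
move=> rp fp f' x; have [s [[sp sx] uniq]] := fp x.
have [sr|sr] := eqVneq s r; last first.
  exists s; split; first by rewrite !inE sr sp !orbT.
  move=> t [+ tx]; rewrite !inE => /orP[/eqP tE|/andP[_ tp]].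
  - by move: tx; rewrite tE f' => rx; rewrite (uniq r) ?eqxx in sr.
  - exact: uniq.
subst s; exists r'; split; first by rewrite !inE eqxx f'.
move=> t [+ tx]; rewrite !inE => /orP[/eqP tE //|/andP[tr tp]].
by rewrite (uniq t) ?eqxx in tr.
Qed.

Lemma caret_tree_pair (p : tree_pair) (q : {fset row}) :
  add_carets p q -> exists2 p' : tree_pair, rows p' = q & tp_equiv p p'.
Proof.
move=> pq; have [pd pr] := rowsP p; have [r rp qE] := pq.
have [p' p'q] : exists p' : tree_pair, rows p' = q.
  by apply: mk_tree_pair; rewrite qE; apply: cover_caret rp _ _ _.
by exists p' => //; apply: rst_step; left; rewrite p'q.
Qed.

Lemma label_tree_pair (p : tree_pair) (q : {fset row}) :
  add_labels p q -> exists2 p' : tree_pair, rows p' = q & tp_equiv p p'.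
Proof.
move=> pq; have [pd pr] := rowsP p; have [r [h [rp qE]]] := pq.
have [p' p'q] : exists p' : tree_pair, rows p' = q.
  by apply: mk_tree_pair; rewrite qE; apply: cover_label rp _ _.
by exists p' => //; apply: rst_step; right; rewrite p'q.
Qed.

Lemma cover_uniq f (p : {fset row}) r s w : covers f p -> r \in p -> s \in p ->
  prefix (f r) w -> prefix (f s) w -> r = s.
Proof.
move=> fp rp sp /prefix_is_prefix rw /prefix_is_prefix sw.
by have [t [_ uniq]] := fp (nth false w); rewrite -(uniq r) // -(uniq s).
Qed.

Lemma cover_ex f (p : {fset row}) w : covers f p ->
  (forall r, r \in p -> size (f r) <= size w) ->
  exists2 r, r \in p & prefix (f r) w.
Proof.
move=> fp pw; have [r [[rp rw] _]] := fp (nth false w).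
by exists r => //; apply: is_prefix_prefix rw; apply: pw.
Qed.

Lemma boundP (f : row -> seq bool) (p : {fset row}) :
  exists n, forall r, r \in p -> size (f r) <= n.
Proof.
exists (\max_(r <- p) size (f r)) => r rp.
exact: (@leq_bigmax_seq _ _ xpredT (fun r => size (f r))).
Qed.

Definition lab (r : row) : gT := r.2.2 * r.1.2^-1.

(* The label reached from [g] after descending along [x] by carets. *)
Definition push (x : seq bool) (g : gT) : gT :=
  foldl (fun g b => if b then theta g else g) g x.

(* [p] sends the word [w] to [v], attaching the group element [h]; equivalent
   tree pairs act in the same way on all long enough words. *)
Definition acts (p : {fset row}) (w v : seq bool) (h : gT) : Prop :=
  exists r x, [/\ r \in p, w = dom_word r ++ x, v = ran_word r ++ x
                & h = push x (lab r)].

Lemma pushM x : {morph push x : g h / g * h}.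
Proof.
by elim: x => [|[] x IHx] g h //=; rewrite /push /= -?IHx ?morphM ?inE.
Qed.

Lemma push1 x : push x 1 = 1.
Proof. by elim: x => [|[] x IHx] //=; rewrite /push /= ?morph1. Qed.

Lemma pushV x g : push x g^-1 = (push x g)^-1.
Proof. by apply/eqP; rewrite eq_mulgV1 invgK -pushM mulVg push1. Qed.

Lemma push_nseq n g : push (nseq n false) g = g.
Proof. by elim: n. Qed.

Lemma lab_caret b r : lab (caret_row b r) = push [:: b] (lab r).
Proof.
case: b => //=; rewrite /lab /push /=.
by rewrite morphM ?inE // morphV ?inE.
Qed.

Lemma lab_label h r : lab (label_row h r) = lab r.
Proof. by rewrite /lab /= invMg mulgA mulgK. Qed.

Definition ev_eq (p q : {fset row}) : Prop :=
  exists n, forall w v h, n <= size w -> acts p w v h <-> acts q w v h.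

Lemma ev_eq_refl p : ev_eq p p.
Proof. by exists 0. Qed.

Lemma ev_eq_sym p q : ev_eq p q -> ev_eq q p.
Proof. by case=> n pq; exists n => w v h /pq->. Qed.

Lemma ev_eq_trans p q r : ev_eq p q -> ev_eq q r -> ev_eq p r.
Proof.
move=> [n pq] [m qr]; exists (maxn n m) => w v h.
by rewrite geq_max => /andP[/pq-> /qr->].
Qed.

Lemma caret_ev_eq p q : add_carets p q -> ev_eq p q.
Proof.
move=> [r rp ->]; exists (size (dom_word r)).+1 => w v h rw.
split=> [[s [x [sp wE vE hE]]]|[s [x [+ wE vE hE]]]]; last first.
  rewrite !inE => /or3P[/eqP sE|/eqP sE|/andP[_ sp]]; last by exists s, x.
  - exists r, (false :: x); split=> //; first by rewrite wE sE /= cat_rcons.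
      by rewrite vE sE /= cat_rcons.
    by rewrite hE sE lab_caret.
  - exists r, (true :: x); split=> //; first by rewrite wE sE /= cat_rcons.
      by rewrite vE sE /= cat_rcons.
    by rewrite hE sE lab_caret.
have [sr|sr] := eqVneq s r; last first.
  by exists s, x; split=> //; rewrite !inE sr sp !orbT.
subst s; case: x wE vE hE => [|b x] wE vE hE.
  by move: rw; rewrite wE cats0 ltnn.
exists (caret_row b r), x; split.
- by rewrite !inE; case: (b); rewrite eqxx ?orbT.
- by rewrite wE /dom_word /= cat_rcons.
- by rewrite vE /ran_word /= cat_rcons.
- by rewrite hE lab_caret.
Qed.

Lemma label_ev_eq p q : add_labels p q -> ev_eq p q.
Proof.
move=> [r [k [rp ->]]]; exists 0 => w v h _.
split=> [[s [x [sp wE vE hE]]]|[s [x [+ wE vE hE]]]]; last first.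
  rewrite !inE => /orP[/eqP sE|/andP[_ sp]]; last by exists s, x.
  by exists r, x; rewrite wE vE hE sE lab_label.
have [sr|sr] := eqVneq s r; last first.
  by exists s, x; split=> //; rewrite !inE sr sp !orbT.
by exists (label_row k r), x; rewrite wE vE hE sr lab_label !inE eqxx.
Qed.

Lemma tp_equiv_ev p q : tp_equiv p q -> ev_eq p q.
Proof.
elim=> {p q} [p q [/caret_ev_eq|/label_ev_eq]|p|p q _|p q r _ pq _ qr] //.
- exact: ev_eq_refl.
- exact: ev_eq_sym.
- exact: ev_eq_trans pq qr.
Qed.

Definition full_depth n (p : {fset row}) : Prop :=
  forall r, r \in p -> size (dom_word r) = n /\ r.1.2 = 1.

Lemma sum_fset1U (F : row -> nat) r (A : {fset row}) :
  (\sum_(s <- r |` A) F s <= F r + \sum_(s <- A) F s)%N.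
Proof.
have [rA|rA] := boolP (r \in A); last by rewrite big_fsetU1.
by rewrite (_ : r |` A = A) ?leq_addl //; apply/fsetUidPr; rewrite fsub1set.
Qed.

Lemma tp_full (p : tree_pair) n :
  (forall r, r \in rows p -> size (dom_word r) <= n) ->
  exists2 q : tree_pair, tp_equiv p q & full_depth n q.
Proof.
pose F r := ((2 ^ (n - size (dom_word r))).-1 + (r.1.2 != 1%g))%N.
have [m] := ubnP (\sum_(r <- rows p) F r); elim: m p => // m IHm p.
rewrite ltnS => Fm pn.
have [/hasP[r rp /orP rb]|/hasPn np] := boolP
    (has (fun r : row => (r.1.2 != 1) || (size (dom_word r) < n)) (rows p));
    last first.
  exists p; first exact: rst_refl.
  move=> r rp; have := np r rp; rewrite /= negb_or negbK -leqNgt.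
  by move=> /andP[/eqP-> nr]; split=> //; apply/eqP; rewrite eqn_leq nr pn.
move: Fm; rewrite (big_fsetD1 r rp) /=; set A := rows p `\ r => Fm.
have [r1|r1] := eqVneq r.1.2 1; last first.
  pose r' := label_row r.1.2^-1 r.
  have [|p' p'E pp'] := @label_tree_pair p (r' |` A).
    by exists r, r.1.2^-1.
  have Fr' : (F r' < F r)%N by rewrite /F /= mulgV eqxx r1 addn0 addn1.
  have [||q p'q qf] := IHm p'.
  - rewrite p'E; apply: leq_ltn_trans (sum_fset1U F r' A) _.
    by apply: leq_trans Fm; rewrite ltn_add2r.
  - move=> s; rewrite p'E !inE => /orP[/eqP->|/andP[_ /pn //]].
    exact: (pn r).
  - by exists q => //; apply: rst_trans pp' p'q.
have {rb} rn : size (dom_word r) < n by case: rb; rewrite ?r1 ?eqxx.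
pose r_ b := caret_row b r.
have [|p' p'E pp'] := @caret_tree_pair p (r_ false |` (r_ true |` A)).
  by exists r.
have Fr' : (F (r_ false) + F (r_ true) < F r)%N.
  rewrite /F /= /dom_word /= !size_rcons r1 morph1 eqxx !addn0.
  rewrite -(subnSK rn) expnS mul2n -addnn.
  by case: (2 ^ _)%N (expn_gt0 2 (n - (size (dom_word r)).+1)) => // k _;
    rewrite /= addnS.
have [||q p'q qf] := IHm p'.
- rewrite p'E; apply: leq_ltn_trans (sum_fset1U F _ _) _.
  apply: leq_ltn_trans (leq_add (leqnn _) (sum_fset1U F _ _)) _.
  by apply: leq_trans Fm; rewrite addnA ltn_add2r.
- move=> s; rewrite p'E !inE => /or3P[/eqP->|/eqP->|/andP[_ /pn //]];
    by rewrite /dom_word /= size_rcons.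
- by exists q => //; apply: rst_trans pp' p'q.
Qed.

Lemma full_sub n (p q : {fset row}) : full_depth n p -> full_depth n q -> ev_eq p q ->
  {subset p <= q}.
Proof.
move=> pf qf [m pq] r rp; have [rn r1] := pf r rp.
pose x := nseq m false.
have /pq : acts p (dom_word r ++ x) (ran_word r ++ x) (lab r).
  by exists r, x; rewrite push_nseq.
case=> [|s [y [sq wE vE hE]]]; first by rewrite size_cat size_nseq leq_addl.
have [sn s1] := qf s sq.
move/eqP: wE; rewrite eqseq_cat ?rn ?sn // => /andP[/eqP du /eqP xy].
have vs : size (ran_word r) = size (ran_word s).
  by have /eqP := congr1 size vE; rewrite -xy !size_cat eqn_add2r => /eqP.
move/eqP: vE; rewrite -xy eqseq_cat //.
case/andP=> /eqP dv _; move: hE; rewrite -xy push_nseq /lab r1 s1 !invg1 !mulg1.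
move=> dg; suff -> : r = s by [].
case: r s {vs} rn r1 sn s1 du dv dg {rp sq} => [[u k] [v g]] [[u' k'] [v' g']].
by rewrite /dom_word /ran_word /= => _ -> _ -> -> -> ->.
Qed.

Lemma ev_tp_equiv (p q : tree_pair) : ev_eq p q -> tp_equiv p q.
Proof.
move=> pq; have [n pn] := boundP dom_word p; have [m qm] := boundP dom_word q.
have [|p' pp' p'f] := @tp_full p (maxn n m).
  by move=> r /pn rn; rewrite leq_max rn.
have [|q' qq' q'f] := @tp_full q (maxn n m).
  by move=> r /qm rm; rewrite leq_max rm orbT.
have p'q' : ev_eq p' q'.
  apply: ev_eq_trans (ev_eq_trans pq (tp_equiv_ev qq')).
  exact: ev_eq_sym (tp_equiv_ev pp').
have E : p' = q'.
  apply: val_inj; apply/fsetP => r /=; apply/idP/idP.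
    exact: full_sub p'f q'f p'q' r.
  exact: full_sub q'f p'f (ev_eq_sym p'q') r.
by apply: rst_trans pp' _; rewrite E; apply: rst_sym.
Qed.

Definition swap_row (r : row) : row := (r.2, r.1).

Definition inv_rows (p : {fset row}) : {fset row} := [fset swap_row r | r in p].

Lemma swap_rowK : involutive swap_row. Proof. by case. Qed.

Lemma in_inv_rows p r : (r \in inv_rows p) = (swap_row r \in p).
Proof.
by rewrite -{1}[r]swap_rowK mem_imfset //; apply: inv_inj swap_rowK.
Qed.

Lemma inv_rowsK : involutive inv_rows.
Proof. by move=> p; apply/fsetP => r; rewrite !in_inv_rows swap_rowK. Qed.

Lemma cover_inv f g (p : {fset row}) :
  (forall r, f (swap_row r) = g r) -> covers g p -> covers f (inv_rows p).
Proof.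
move=> fg gp x; have [r [[rp rx] uniq]] := gp x; exists (swap_row r); split.
  by rewrite in_inv_rows swap_rowK fg.
move=> s [sp sx]; rewrite -[s]swap_rowK; congr swap_row; apply: uniq.
by rewrite -in_inv_rows -fg swap_rowK.
Qed.

Lemma inv_validP (p : tree_pair) : `[< is_tree_pair (inv_rows p) >].
Proof.
have [pd pr] := rowsP p; apply/asboolP/is_tree_pairP.
by split; [apply: cover_inv pr|apply: cover_inv pd].
Qed.

Definition inv_tp (p : tree_pair) : tree_pair := TreePair (inv_validP p).

Lemma inv_tpK : involutive inv_tp.
Proof. by move=> p; apply: val_inj; apply: inv_rowsK. Qed.

Lemma swap_row_eq (r s : row) : (swap_row r == s) = (r == swap_row s).
Proof. by rewrite (inv_eq swap_rowK). Qed.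

Lemma inv_tp_equiv p q : tp_equiv p q -> tp_equiv (inv_tp p) (inv_tp q).
Proof.
elim=> {p q} [p q pq|p|p q _ pq|p q r _ pq _ qr].
- apply: rst_step; case: pq => [[r rp E]|[r [h [rp E]]]]; [left|right].
    exists (swap_row r); rewrite ?in_inv_rows ?swap_rowK //=; apply/fsetP => s.
    by rewrite in_inv_rows E !inE in_inv_rows !swap_row_eq.
  exists (swap_row r), h; rewrite ?in_inv_rows ?swap_rowK //; split=> //=.
  by apply/fsetP => s; rewrite in_inv_rows E !inE in_inv_rows !swap_row_eq.
- exact: rst_refl.
- exact: rst_sym.
- exact: rst_trans pq qr.
Qed.

Lemma acts_inv p w v h : acts (inv_rows p) w v h <-> acts p v w h^-1.
Proof.
split=> [[r [x [rp -> -> ->]]]|[r [x [rp -> -> hE]]]]; exists (swap_row r), x.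
  by rewrite -in_inv_rows -pushV /lab /= invMg invgK.
rewrite in_inv_rows swap_rowK; split=> //; apply: invg_inj.
by rewrite hE -pushV /lab /= invMg invgK.
Qed.

Definition composable (p q : {fset row}) : Prop := dom_tree p = ran_tree q.

Lemma dom_tree_inv p : dom_tree (inv_rows p) = ran_tree p.
Proof.
apply/fsetP => l; apply/imfsetP/imfsetP => /= -[r rp ->].
  by exists (swap_row r); rewrite -?in_inv_rows.
by exists (swap_row r); rewrite // in_inv_rows swap_rowK.
Qed.

Lemma ran_tree_inv p : ran_tree (inv_rows p) = dom_tree p.
Proof. by rewrite -dom_tree_inv inv_rowsK. Qed.

Lemma composable_inv p q :
  composable p q -> composable (inv_rows q) (inv_rows p).
Proof. by rewrite /composable dom_tree_inv ran_tree_inv. Qed.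

Lemma comp_rowsP p q r : reflect
  (exists s t, [/\ s \in q, t \in p, s.2 = t.1 & r = (s.1, t.2)])
  (r \in comp_rows p q).
Proof.
apply: (iffP (imfset2P _ _ _ _ _)) => /=.
  move=> [s sq [t]]; rewrite inE => /andP[tp /eqP st] ->; by exists s, t.
move=> [s [t [sq tp st ->]]]; exists s => //; exists t => //.
by rewrite inE tp /= st.
Qed.

Lemma comp_inv p q :
  inv_rows (comp_rows p q) = comp_rows (inv_rows q) (inv_rows p).
Proof.
apply/fsetP => r; rewrite in_inv_rows.
apply/comp_rowsP/comp_rowsP => -[s [t [sq tp st rE]]].
  exists (swap_row t), (swap_row s); rewrite !in_inv_rows !swap_rowK; split=> //.
  by rewrite -[r]swap_rowK rE.
exists (swap_row t), (swap_row s); rewrite -!in_inv_rows; split=> //.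
by rewrite rE.
Qed.

Lemma composableP p q s : composable p q -> s \in q ->
  exists2 t, t \in p & s.2 = t.1.
Proof.
move=> pq sq; have : s.2 \in ran_tree q by apply/imfsetP; exists s.
by rewrite -pq => /imfsetP[t /= tp ->]; exists t.
Qed.

Lemma cover_comp p q : composable p q -> covers dom_word p ->
  covers dom_word q -> covers dom_word (comp_rows p q).
Proof.
move=> pq pd qd x; have [s [[sq sx] uniq]] := qd x.
have [t tp st] := composableP pq sq.
exists (s.1, t.2); split.
  by split=> //; apply/comp_rowsP; exists s, t.
move=> _ [/comp_rowsP[s' [t' [s'q t'p st' ->]]]] s'x.
have E : s = s' by apply: uniq.
subst s'; rewrite (_ : t' = t) //.
have /coverP[dinj _] := pd.
by apply: dinj => //; rewrite /dom_word -st -st'.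
Qed.

Lemma comp_tree_pair (p q : tree_pair) : composable p q ->
  exists r : tree_pair, rows r = comp_rows p q.
Proof.
move=> pq; have [pd pr] := rowsP p; have [qd qr] := rowsP q.
apply: mk_tree_pair; first exact: cover_comp.
rewrite -[comp_rows p q]inv_rowsK comp_inv.
apply: (@cover_inv _ dom_word) => //; apply: cover_comp.
- exact: composable_inv.
- by have [] := rowsP (inv_tp q).
- by have [] := rowsP (inv_tp p).
Qed.

Lemma full_dom n (p : tree_pair) u k : full_depth n p ->
  ((u, k) \in dom_tree p) = (size u == n) && (k == 1).
Proof.
move=> pf; apply/imfsetP/andP => /= [[r rp rE]|[/eqP un /eqP->]].
  by have [<- <-] := pf r rp; rewrite /dom_word -rE.
have [r rp ru] : exists2 r, r \in rows p & prefix (dom_word r) u.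
  apply: cover_ex; first by have [] := rowsP p.
  by move=> r /pf[-> _]; rewrite un.
have [rn r1] := pf r rp; exists r => //; move: ru.
rewrite prefixE rn -un take_size => /eqP->.
by rewrite -r1 -surjective_pairing.
Qed.

Definition is_product (x y z : thompsonV) : Prop :=
  exists p q r : tree_pair, [/\ x = vclass p, y = vclass q, z = vclass r,
    dom_tree p = ran_tree q & rows r = comp_rows p q].

Lemma product_exists x y : exists z, is_product x y z.
Proof.
have [p ->] := vclass_surj x; have [q ->] := vclass_surj y.
have [n pn] := boundP dom_word p.
have [m qm] := boundP dom_word (inv_tp q).
have [|p' pp' p'f] := @tp_full p (maxn n m).
  by move=> r /pn rn; rewrite leq_max rn.
have [|q' qq' q'f] := @tp_full (inv_tp q) (maxn n m).
  by move=> r /qm rm; rewrite leq_max rm orbT.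
have cp : composable p' (inv_tp q').
  rewrite /composable ran_tree_inv; apply/fsetP => -[u k].
  by rewrite (full_dom _ _ q'f) -(full_dom _ _ p'f).
have [r rE] := comp_tree_pair cp.
exists (vclass r), p', (inv_tp q'), r; split=> //; apply/vclassP => //.
by rewrite -[q]inv_tpK; apply: inv_tp_equiv.
Qed.

(* Eventually, the action of [r] is that of [q] followed by that of [p]. *)
Definition ev_comp (p q r : {fset row}) : Prop :=
  exists n, forall w v h, n <= size w ->
    acts r w v h <->
    exists u g k, [/\ acts q w u g, acts p u v k & h = k * g].

Lemma acts_comp (p q : tree_pair) w v h : composable p q ->
  acts (comp_rows p q) w v h <->
  exists u g k, [/\ acts q w u g, acts p u v k & h = k * g].
Proof.
move=> pq; split=> [[_ [x [/comp_rowsP[s [t [sq tp st ->]]] -> -> ->]]]|].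
  exists (ran_word s ++ x), (push x (lab s)), (push x (lab t)).
  split; first by exists s, x.
    by exists t, x; split; rewrite // /ran_word st.
  by rewrite -pushM /lab /= st mulgA mulgKV.
move=> [u [g [k [[s [x [sq -> uE ->]]] [t [y [tp uE' -> ->]]] ->]]]].
have [t' t'p st] := composableP pq sq.
have E : t' = t.
  have [pd _] := rowsP p; apply: (cover_uniq (w := u) pd) => //.
    by rewrite uE /ran_word st prefix_prefix.
  by rewrite uE' prefix_prefix.
subst t'; have /eqP : ran_word s ++ x = dom_word t ++ y by rewrite -uE.
rewrite /ran_word st eqseq_cat // => /andP[_ /eqP<-].
exists (s.1, t.2), x; split=> //; first by apply/comp_rowsP; exists s, t.
by rewrite -pushM /lab /= st mulgA mulgKV.
Qed.

Lemma acts_size (p : {fset row}) n :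
  exists m, forall w v h, acts p w v h -> m <= size w -> n <= size v.
Proof.
have [d pd] := boundP dom_word p; exists (d + n)%N => w v h.
move=> [r [x [rp -> -> _]]]; rewrite !size_cat => H.
apply: leq_trans (leq_addl _ _); rewrite -(leq_add2l d).
by apply: leq_trans H _; rewrite leq_add2r pd.
Qed.

Lemma ev_comp_eq p p' q q' r r' :
  ev_eq p p' -> ev_eq q q' -> ev_eq r r' -> ev_comp p q r -> ev_comp p' q' r'.
Proof.
move=> [a pp'] [b qq'] [c rr'] [d pqr].
have [e qe] := acts_size q a.
exists (maxn (maxn b c) (maxn d e)) => w v h.
rewrite !geq_max => /andP[/andP[wb wc] /andP[wd we]].
rewrite -rr' // pqr //; split=> -[u [g [k [qu pu ->]]]]; exists u, g, k.
  by split=> //; [apply/qq'|apply/pp' => //; apply: qe qu we].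
by have /qq' qu' := qu; split; auto; apply/pp' => //; apply: (qe w u g); auto.
Qed.

Lemma is_productP (p q r : tree_pair) :
  is_product (vclass p) (vclass q) (vclass r) <-> ev_comp p q r.
Proof.
have prodW a b c : is_product (vclass a) (vclass b) (vclass c) ->
    ev_comp a b c.
  move=> [p' [q' [r' [/vclassP pp' /vclassP qq' /vclassP rr' cp rE]]]].
  apply: (@ev_comp_eq p' _ q' _ r').
  - exact: ev_eq_sym (tp_equiv_ev pp').
  - exact: ev_eq_sym (tp_equiv_ev qq').
  - exact: ev_eq_sym (tp_equiv_ev rr').
  - by exists 0 => w v h _; rewrite rE; apply: acts_comp.
split=> [/prodW //|[n pqr]].
have [z] := product_exists (vclass p) (vclass q).
have [t ->] := vclass_surj z => pqt; rewrite (_ : vclass r = vclass t) //.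
apply/vclassP; apply: ev_tp_equiv; have [m pqt'] := prodW _ _ _ pqt.
exists (maxn n m) => w v h; rewrite geq_max => /andP[wn wm].
by rewrite pqr // pqt'.
Qed.

Lemma product_uniq x y z z' : is_product x y z -> is_product x y z' -> z = z'.
Proof.
have [[p ->] [q ->]] := (vclass_surj x, vclass_surj y).
have [[r ->] [t ->]] := (vclass_surj z, vclass_surj z').
move=> /is_productP[n pqr] /is_productP[m pqt].
apply/vclassP; apply: ev_tp_equiv.
exists (maxn n m) => w v h; rewrite geq_max => /andP[wn wm].
by rewrite pqr // pqt.
Qed.

(* The product of two classes is chosen among the classes obtained from any
   composable representatives; by [thompsonV_mulP] there is only one. *)
Definition thompsonV_mul (x y : thompsonV) : thompsonV := sval (cid (product_exists x y)).

Lemma thompsonV_mulP x y z : is_product x y z <-> z = thompsonV_mul x y.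
Proof.
have xy : is_product x y (thompsonV_mul x y) := svalP (cid (product_exists x y)).
by split=> [xyz|->//]; apply: product_uniq xyz xy.
Qed.

Lemma thompsonV_mulE (p q r : tree_pair) :
  vclass r = thompsonV_mul (vclass p) (vclass q) <-> ev_comp p q r.
Proof. by rewrite -thompsonV_mulP is_productP. Qed.

Definition one_rows : {fset row} := [fset (([::], 1), ([::], 1))].

Lemma one_validP : `[< is_tree_pair one_rows >].
Proof.
by apply/asboolP/is_tree_pairP; split=> x;
  exists (([::], 1), ([::], 1)); split; rewrite ?inE // => r [];
  rewrite inE => /eqP->.
Qed.

Definition one_tp : tree_pair := TreePair one_validP.

Definition thompsonV_one : thompsonV := vclass one_tp.

Lemma acts_one w v h : acts one_rows w v h <-> v = w /\ h = 1.
Proof.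
split=> [[r [x []]]|[-> ->]].
  by rewrite inE => /eqP-> -> -> ->; rewrite /lab /= mulgV push1.
exists (([::], 1), ([::], 1)), w.
by rewrite inE eqxx /lab mulgV push1.
Qed.

Lemma inv_equiv_class p q : vclass p = vclass q ->
  vclass (inv_tp p) = vclass (inv_tp q).
Proof. by move=> /vclassP pq; apply/vclassP/inv_tp_equiv. Qed.

Definition thompsonV_inv (x : thompsonV) : thompsonV :=
  vclass (inv_tp (generic_quotient.repr x)).

Lemma thompsonV_invE p : thompsonV_inv (vclass p) = vclass (inv_tp p).
Proof. by apply: inv_equiv_class; rewrite /vclass reprK. Qed.

Lemma thompsonV_mulA : associative thompsonV_mul.
Proof.
move=> x y z; have [p ->] := vclass_surj x; have [q ->] := vclass_surj y.
have [r ->] := vclass_surj z.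
have [pq pqE] := vclass_surj (thompsonV_mul (vclass p) (vclass q)).
have [qr qrE] := vclass_surj (thompsonV_mul (vclass q) (vclass r)).
have [s sE] := vclass_surj (thompsonV_mul (vclass p) (vclass qr)).
rewrite pqE qrE sE.
move: pqE qrE sE => /esym/thompsonV_mulE[a pqE] /esym/thompsonV_mulE[b qrE].
move=> /esym/thompsonV_mulE[c sE]; apply/thompsonV_mulE.
have [d rd] := acts_size r a.
exists (maxn (maxn b c) d) => w v h; rewrite !geq_max => /andP[/andP[wb wc] wd].
rewrite sE //; split.
  move=> [u [g [k [/qrE-/(_ wb)[u' [g' [k' [ru qu ->]]]] pu ->]]]].
  exists u', g', (k * k'); split=> //; last by rewrite mulgA.
  by apply/pqE; [apply: rd ru wd|exists u, k', k].
move=> [u [g [k [ru /pqE-/(_ (rd _ _ _ ru wd))[u' [g' [k' [qu pu ->]]]] ->]]]].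
exists u', (g' * g), k'; split=> //; last by rewrite mulgA.
by apply/qrE => //; exists u, g, g'.
Qed.

Lemma thompsonV_mul1g : left_id thompsonV_one thompsonV_mul.
Proof.
move=> x; have [p ->] := vclass_surj x; apply/esym/thompsonV_mulE.
exists 0 => w v h _; split=> [pw|[u [g [k [pu /acts_one[-> ->] ->]]]]].
  by exists v, h, 1; rewrite mul1g; split=> //; apply/acts_one.
by rewrite mul1g.
Qed.

Lemma thompsonV_mulg1 : right_id thompsonV_one thompsonV_mul.
Proof.
move=> x; have [p ->] := vclass_surj x; apply/esym/thompsonV_mulE.
exists 0 => w v h _; split=> [pw|[u [g [k [/acts_one[-> ->] pu ->]]]]].
  by exists w, 1, h; rewrite mulg1; split=> //; apply/acts_one.
by rewrite mulg1.
Qed.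

Lemma acts_fun (p : tree_pair) w v v' h h' :
  acts p w v h -> acts p w v' h' -> v = v' /\ h = h'.
Proof.
move=> [r [x [rp wE -> ->]]] [s [y [sp wE' -> ->]]]; have [pd _] := rowsP p.
have E : r = s.
  apply: (cover_uniq (w := w) pd) => //; first by rewrite wE prefix_prefix.
  by rewrite wE' prefix_prefix.
subst s; have /eqP : dom_word r ++ x = dom_word r ++ y by rewrite -wE.
by rewrite eqseq_cat // eqxx /= => /eqP->.
Qed.

Lemma acts_total (p : tree_pair) :
  exists n, forall w, n <= size w -> exists v h, acts p w v h.
Proof.
have [n pn] := boundP dom_word p; exists n => w nw; have [pd _] := rowsP p.
have [|r rp /prefixP[x ->]] := cover_ex (w := w) pd.
  by move=> r /pn rn; apply: leq_trans rn nw.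
by exists (ran_word r ++ x), (push x (lab r)), r, x.
Qed.

Lemma thompsonV_mulVg : left_inverse thompsonV_one thompsonV_inv thompsonV_mul.
Proof.
move=> x; have [p ->] := vclass_surj x; rewrite thompsonV_invE.
apply/esym/thompsonV_mulE; have [n pn] := acts_total p.
exists n => w v h nw; rewrite acts_one; split=> [[-> ->]|].
  have [u [g pu]] := pn w nw; exists u, g, g^-1; rewrite mulVg; split=> //.
  by apply/acts_inv; rewrite invgK.
move=> [u [g [k [pu pu' ->]]]].
have pu2 : acts (inv_tp p) u w g^-1 by apply/acts_inv; rewrite invgK.
by have [-> ->] := acts_fun pu' pu2; rewrite mulVg.
Qed.

Lemma thompsonV_mulgV : right_inverse thompsonV_one thompsonV_inv thompsonV_mul.
Proof.
move=> x; have [p ->] := vclass_surj x.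
by rewrite thompsonV_invE -{1}[p]inv_tpK -thompsonV_invE thompsonV_mulVg.
Qed.

HB.instance Definition _ := isGroup.Build thompsonV
  thompsonV_mulA thompsonV_mul1g thompsonV_mulg1 thompsonV_mulVg thompsonV_mulgV.

End GeneralizedThompson.

(* Main.v *)
Require Import Defs.
From Stdlib Require Import Relation_Operators Operators_Properties.
From mathcomp Require Import all_boot all_fingroup finmap.
From mathcomp Require Import boolp.

(* Finite generation: a tree pair with at least six rows is a product of three
   tree pairs admitting caret reductions, so the finitely many tree pairs with
   at most five rows generate.

   Co-word problem: a pushdown automaton reads a product of generators from the
   left and applies their inverses in turn to a binary word, which it guesses
   letter by letter at the bottom of the stack when the stack is exhausted. Two
   facts can witness that the product is not 1. Either the attached label is
   nontrivial: labels are kept on the stack and pushed through the letters at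
   the end. Or the final word y differs from the guessed word x: each guessed
   letter also leaves a marker, so that the markers spell x with its last letter
   on top. After the moment at which the stack is exhausted for the last time,
   the letters of y that remain forever are pushed in order from the last one,
   and each of them is compared with the top marker, which is then erased. *)

Set Implicit Arguments.
Unset Strict Implicit.
Unset Printing Implicit Defensive.

(** * Finite generation by tree pairs with at most five rows *)

Section FiniteGeneration.
Variables (gT : finGroupType) (theta : {morphism [set: gT] >-> gT}).
Local Open Scope fset_scope.
Local Open Scope group_scope.

Local Notation row := ((seq bool * gT) * (seq bool * gT))%type.
Local Notation V := (thompsonV theta).
Implicit Types (p : {fset row}) (r : row) (f : row -> seq bool).

Lemma prefix_rconsP (u x : seq bool) b :
  prefix u (rcons x b) -> u = rcons x b \/ prefix u x.
Proof.
move=> /prefixP[t]; case/lastP: t => [|t c]; first by rewrite cats0; left.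
rewrite -rcons_cat => /rcons_inj[-> _]; right; exact: prefix_prefix.
Qed.

(** A leaf of maximal depth is one half of such a caret: the leaf covering its sibling word is that
    word itself or a prefix of the common parent, and the latter would also cover the first leaf. *)
Lemma exposed_caret f p : covers f p -> (1 < #|` p|)%N ->
  exists r0 r1 x, [/\ r0 \in p, r1 \in p, f r0 = rcons x false
                    & f r1 = rcons x true].
Proof.
move=> fp p1.
have [r rp rmax] : exists2 r, r \in p &
    forall s, s \in p -> size (f s) <= size (f r).
  have /fset0Pn[r0 r0p] : p != fset0 by rewrite -cardfs_gt0 (ltn_trans _ p1).
  have [//|r _ rmax] :=
    @arg_maxnP _ [` r0p] xpredT (fun s => size (f (fsval s))).
  by exists (fsval r); [apply: fsvalP|move=> s sp; apply: (rmax [` sp])].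
case/lastP E : (f r) => [|x b].
  suff : p = [fset r] by move=> pE; rewrite pE cardfs1 in p1.
  apply/fsetP => s; rewrite inE; apply/idP/eqP => [sp|-> //].
  by apply: (cover_uniq (w := f s) fp) => //; rewrite ?E ?prefix0s ?prefix_refl.
have [|s sp] := cover_ex (w := rcons x (~~ b)) fp.
  by move=> s /rmax; rewrite E !size_rcons.
move=> /prefix_rconsP[sE|sx].
  by case: b E sE => E sE; [exists s, r, x|exists r, s, x].
have sr : s = r.
  apply: (cover_uniq (w := f r) fp) => //; rewrite ?prefix_refl // E.
  by apply: prefix_trans sx _; rewrite -cats1 prefix_prefix.
have := size_prefix sx; rewrite sr E size_rcons.
by rewrite ltnn.
Qed.

Lemma caret_neq f r0 r1 x :
  f r0 = rcons x false -> f r1 = rcons x true -> r0 != r1.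
Proof.
by move=> e0 e1; apply/eqP => r01; move: e0; rewrite r01 e1 => /rcons_inj[].
Qed.

(** From here on [p] serves as an index set for the leaves and [f] gives their words. Once [r1] is
    deleted, [r0] takes the parent word [x] of the caret. *)
Definition merge_at (r0 : row) x f r := if r == r0 then x else f r.

Lemma covers_merge f p r0 r1 x : covers f p -> r0 \in p -> r1 \in p ->
  f r0 = rcons x false -> f r1 = rcons x true ->
  covers (merge_at r0 x f) (p `\ r1).
Proof.
move=> fp r0p r1p f0 f1 y.
have r01 := caret_neq f0 f1.
have ne s : s \in p -> s != r0 -> s != r1 -> is_prefix (f s) y ->
    is_prefix x y -> False.
  move=> sp s0 s1 sy xy; have [t [_ tu]] := fp y.
  have ts := tu s (conj sp sy).
  case E : (y (size x)).
    have : r1 \in p /\ is_prefix (f r1) y.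
      by rewrite f1; split=> //; apply/is_prefix_rcons.
    by move=> /tu tr; move: s1; rewrite -ts tr eqxx.
  have : r0 \in p /\ is_prefix (f r0) y.
    by rewrite f0; split=> //; apply/is_prefix_rcons.
  by move=> /tu tr; move: s0; rewrite -ts tr eqxx.
have [s [[sp sy] su]] := fp y.
have [xy|xy] := pselect (is_prefix x y).
  exists r0; split; first by rewrite /merge_at eqxx !inE r01.
  move=> t [+]; rewrite /merge_at !inE => /andP[t1 tp].
  by case: eqVneq => // t0 ty; case: (ne t tp t0 t1 ty xy).
have s0 : s != r0.
  by apply/eqP => s0; move: sy; rewrite s0 f0 => /is_prefix_rcons[].
have s1 : s != r1.
  by apply/eqP => s1; move: sy; rewrite s1 f1 => /is_prefix_rcons[].
exists s; split; first by rewrite /merge_at (negPf s0) !inE s1 sp.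
move=> t [+]; rewrite /merge_at !inE => /andP[t1 tp].
by case: eqVneq => // t0 ty; apply: su.
Qed.

Definition split_at (r0 r1 : row) f r :=
  if r == r1 then rcons (f r0) true else
  if r == r0 then rcons (f r0) false else f r.

Lemma covers_split f p r0 r1 : covers f (p `\ r1) -> r0 \in p -> r1 \in p ->
  r0 != r1 -> covers (split_at r0 r1 f) p.
Proof.
move=> fp r0p r1p r01 y; have [s [[+ sy] su]] := fp y.
rewrite !inE => /andP[s1 sp].
have [s0|s0] := eqVneq s r0.
  subst s; exists (if y (size (f r0)) then r1 else r0).
  split.
    case: ifP => E; rewrite /split_at ?eqxx ?(negPf r01); split=> //;
      exact/is_prefix_rcons.
  move=> t [tp]; rewrite /split_at; have [->|t1] := eqVneq.
    by case/is_prefix_rcons => _ ->.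
  have [->|t0] := eqVneq; first by case/is_prefix_rcons => _ ->.
  by move=> ty; move: t0; rewrite (su t) ?eqxx // !inE t1.
exists s; split; first by rewrite /split_at (negPf s1) (negPf s0).
move=> t [tp]; rewrite /split_at; have [->|t1] := eqVneq.
  case/is_prefix_rcons => ry _; move: s0; rewrite (su r0) ?eqxx //.
  by rewrite !inE r01.
have [->|t0] := eqVneq.
  case/is_prefix_rcons => ry _; move: s0; rewrite (su r0) ?eqxx //.
  by rewrite !inE r01.
by move=> ty; apply: su; rewrite !inE t1.
Qed.

Lemma covers_exists p : (0 < #|` p|)%N -> exists f, covers f p.
Proof.
have [n] := ubnP #|` p|; elim: n p => // n IHn p; rewrite ltnS => pn p0.
have /fset0Pn[r0 r0p] : p != fset0 by rewrite -cardfs_gt0.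
have [/eqP pE|/fset0Pn[r1]] := boolP (p `\ r0 == fset0).
  exists (fun=> [::]) => y; exists r0; split=> // t [tp _]; apply/esym/eqP.
  have : t \notin p `\ r0 by rewrite pE inE.
  by rewrite !inE tp andbT negbK.
rewrite !inE => /andP[r10 r1p]; have := cardfsD1 r1 p; rewrite r1p => pE.
have [||f fp] := IHn (p `\ r1).
- by rewrite pE in pn.
- by rewrite cardfs_gt0; apply/fset0Pn; exists r0; rewrite !inE eq_sym r10.
by exists (split_at r0 r1 f); apply: covers_split; rewrite // eq_sym.
Qed.

(** Merging an exposed caret removes one leaf and lowers the depth by at most one. *)
Lemma covers_size f p r : covers f p -> r \in p -> (size (f r) < #|` p|)%N.
Proof.
move en : #|` p| => n; elim: n f p r en => [|n IHn] f p r pn fp rp.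
  by move: rp; rewrite (cardfs0_eq pn) inE.
have [n0|n0] := posnP n.
  have /cardfs1P[s pE] : #|` p| == 1%N by rewrite pn n0.
  case E : (f r) => [|b x] //.
  have [t [[tp] + _]] := fp (fun=> ~~ b).
  have -> : t = r by move: tp rp; rewrite pE !inE => /eqP-> /eqP->.
  by rewrite E /is_prefix /= => -[]; case: (b).
have [|r0 [r1 [x [r0p r1p f0 f1]]]] := exposed_caret fp; first by rewrite pn.
have r01 := caret_neq f0 f1.
have pn' : #|` p `\ r1| = n.
  by have := cardfsD1 r1 p; rewrite r1p pn => -[].
have fp' := covers_merge fp r0p r1p f0 f1.
have x_n : (size x < n)%N.
  have := IHn _ _ r0 pn' fp'; rewrite /merge_at eqxx; apply.
  by rewrite !inE r01.
have [->|re1] := eqVneq r r1; first by rewrite f1 size_rcons.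
have [->|re0] := eqVneq r r0; first by rewrite f0 size_rcons.
have := IHn _ _ r pn' fp'; rewrite /merge_at (negPf re0) => H.
by apply: ltnW; apply: H; rewrite !inE re1.
Qed.

Lemma covers_image (h : row -> row) f p :
  covers (f \o h) p -> covers f [fset h r | r in p].
Proof.
move=> fp x; have [r [[rp rx] uniq]] := fp x; exists (h r); split.
  by split=> //; apply/imfsetP; exists r.
by move=> _ [/imfsetP[s /= sp ->] sx]; rewrite (uniq s).
Qed.

Definition relabel p f1 f2 (l : row -> gT) : {fset row} :=
  [fset ((f1 r, 1), (f2 r, l r)) | r in p].

Lemma acts_relabel p f1 f2 l w v h : acts theta (relabel p f1 f2 l) w v h <->
  exists r x,
    [/\ r \in p, w = f1 r ++ x, v = f2 r ++ x & h = push theta x (l r)].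
Proof.
split=> [[_ [x [/imfsetP[r /= rp ->] -> -> ->]]]|[r [x [rp -> -> ->]]]].
  by exists r, x; rewrite /lab /= invg1 mulg1.
exists ((f1 r, 1), (f2 r, l r)), x; rewrite /lab /= invg1 mulg1; split=> //.
by apply/imfsetP; exists r.
Qed.

Lemma relabel_tree_pair p f1 f2 l : covers f1 p -> covers f2 p ->
  exists q : tree_pair gT, rows q = relabel p f1 f2 l.
Proof. by move=> fp1 fp2; apply: mk_tree_pair; apply: covers_image. Qed.

Lemma vclass_ev_eq (p q : tree_pair gT) :
  vclass theta p = vclass theta q <-> ev_eq theta p q.
Proof.
by split=> [/vclassP/tp_equiv_ev|/ev_tp_equiv/vclassP].
Qed.

Lemma tree_pair_relabel (p q : tree_pair gT) :
  rows q = relabel p (@dom_word _) (@ran_word _) (@lab _) ->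
  vclass theta p = vclass theta q.
Proof.
by move=> qE; apply/vclass_ev_eq; exists 0 => w v h _; rewrite qE acts_relabel.
Qed.

(** The middle tree [f2] may be chosen freely, so a tree pair factors through a tree with prescribed
    carets. *)
Lemma relabel_mul p f1 f2 f3 l1 l2 (q1 q2 q3 : tree_pair gT) :
  covers f2 p -> rows q1 = relabel p f1 f2 l1 -> rows q2 = relabel p f2 f3 l2 ->
  rows q3 = relabel p f1 f3 (fun r => l2 r * l1 r) ->
  vclass theta q3 = vclass theta q2 * vclass theta q1 :> V.
Proof.
move=> fp q1E q2E q3E; apply/thompsonV_mulE; exists 0 => w v h _.
rewrite q1E q2E q3E acts_relabel; split.
  move=> [r [x [rp -> -> ->]]].
  exists (f2 r ++ x), (push theta x (l1 r)), (push theta x (l2 r)).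
  by rewrite pushM; split=> //; apply/acts_relabel; exists r, x.
move=> [u [g [k [/acts_relabel[r [x [rp -> uE ->]]]]]]].
move=> /acts_relabel[s [y [sp uE' -> ->]] ->].
have rs : s = r.
  apply: (cover_uniq (w := u) fp) => //; first by rewrite uE' prefix_prefix.
  by rewrite uE prefix_prefix.
subst s; exists r, x; rewrite pushM; move: uE'; rewrite uE.
by move=> /eqP; rewrite eqseq_cat // => /andP[_ /eqP->].
Qed.

(** This reverses the caret move. Both labels are 1, and 1 stays 1 when pushed along any word. *)
Lemma relabel_merge p f1 f2 l r0 r1 x y (q : tree_pair gT) :
  covers f1 p -> covers f2 p -> r0 \in p -> r1 \in p ->
  f1 r0 = rcons x false -> f1 r1 = rcons x true ->
  f2 r0 = rcons y false -> f2 r1 = rcons y true -> l r0 = 1 -> l r1 = 1 ->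
  rows q = relabel p f1 f2 l ->
  exists2 q' : tree_pair gT,
    rows q' = relabel (p `\ r1) (merge_at r0 x f1) (merge_at r0 y f2) l
    & vclass theta q = vclass theta q'.
Proof.
move=> fp1 fp2 r0p r1p f10 f11 f20 f21 l0 l1 qE.
have [q' q'E] := relabel_tree_pair l (covers_merge fp1 r0p r1p f10 f11)
  (covers_merge fp2 r0p r1p f20 f21).
have r01 := caret_neq f10 f11.
(* A word of this length that begins with [x] has a next letter, which selects [r0] or [r1]. *)
exists q' => //; apply/vclass_ev_eq; exists (size x).+1 => w v h xw.
rewrite qE q'E !acts_relabel; split=> -[r [z [rp wE vE ->]]]; last first.
  move: rp wE vE; rewrite !inE /merge_at => /andP[r_1 rp].
  have [->|r_0] := eqVneq r r0; last by exists r, z.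
  case: z => [|b z] wE vE; first by rewrite wE cats0 ltnn in xw.
  rewrite wE vE l0 push1; case: (b).
    by exists r1, z; rewrite f11 f21 l1 push1 !cat_rcons.
  by exists r0, z; rewrite f10 f20 l0 push1 !cat_rcons.
have [r_1|r_1] := eqVneq r r1.
  exists r0, (true :: z); rewrite !inE r01 r0p /merge_at eqxx wE vE r_1.
  by rewrite f11 f21 l0 l1 !push1 !cat_rcons.
have [r_0|r_0] := eqVneq r r0.
  exists r0, (false :: z); rewrite !inE r01 r0p /merge_at eqxx wE vE r_0.
  by rewrite f10 f20 l0 !push1 !cat_rcons.
by exists r, z; rewrite !inE r_1 rp /merge_at (negPf r_0).
Qed.

(** Take any tree indexed by the rows other than [r1] and [s1], then split its leaves at [s0] and
    [r0]. *)
Lemma covers_two_carets p r0 r1 s0 s1 : r0 \in p -> r1 \in p -> s0 \in p ->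
  s1 \in p -> uniq [:: r0; r1; s0; s1] ->
  exists f, covers f p /\ exists x y,
    [/\ f r0 = rcons x false, f r1 = rcons x true, f s0 = rcons y false
      & f s1 = rcons y true].
Proof.
move=> r0p r1p s0p s1p /=; rewrite !inE !negb_or.
move=> /and4P[/and3P[r01 r0s0 r0s1] /andP[r1s0 r1s1] s01 _].
have [|f fp] := @covers_exists (p `\ r1 `\ s1).
  by rewrite cardfs_gt0; apply/fset0Pn; exists r0; rewrite !inE r01 r0s1.
exists (split_at r0 r1 (split_at s0 s1 f)); split.
  apply: covers_split => //; apply: covers_split => //;
    by rewrite !inE ?s0p ?s1p eq_sym ?r1s0 ?r1s1.
exists (f r0), (f s0); rewrite /split_at !eqxx.
rewrite (negPf r01) (negPf r0s1) (negPf r0s0) !(eq_sym _ r0) !(eq_sym _ r1).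
by rewrite (negPf r1s0) (negPf r1s1) (negPf r0s1) (negPf r0s0) (negPf s01).
Qed.

Lemma two_more (A : seq row) p : (size A + 2 <= #|` p|)%N ->
  exists a b, [/\ a \in p, b \in p, a != b, a \notin A & b \notin A].
Proof.
move=> Ap; pose B := [fset x in p | x \notin A].
have B2 : (1 < #|` B|)%N.
  have : (#|` p| <= #|` B| + size A)%N.
    have pB : p `<=` B `|` [fset x in A].
      by apply/fsubsetP => x xp; rewrite !inE xp /=; case: (x \in A).
    apply: leq_trans (fsubset_leq_card pB) _; rewrite cardfsU.
    apply: leq_trans (leq_subr _ _) _; rewrite leq_add2l card_fseq.
    exact: size_undup.
  move=> H; have := leq_trans Ap H.
  by rewrite addnC leq_add2r.
have /fset0Pn[a aB] : B != fset0 by rewrite -cardfs_gt0 (ltn_trans _ B2).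
have : B `\ a != fset0.
  rewrite -cardfs_gt0; have E := cardfsD1 a B; rewrite aB in E.
  by rewrite E in B2.
case/fset0Pn => b; move: aB; rewrite !inE => /andP[ap aA] /and3P[ba bp bA].
by exists a, b; rewrite eq_sym.
Qed.

(* In the factorization of a large tree pair, the outer factors carry the exposed
   carets of the domain and range tree, and the middle one carries a caret on two
   rows away from these. The labels at the domain caret go into the middle one. *)
Lemma small_generate (H : V -> Prop) :
  (forall x y, H x -> H y -> H (x * y)) ->
  (forall q : tree_pair gT, (#|` rows q| <= 5)%N -> H (vclass theta q)) ->
  forall x, H x.
Proof.
move=> HM Hs x; have [q ->] := vclass_surj x.
suff main n p f1 f2 l (t : tree_pair gT) : (#|` p| <= n)%N -> covers f1 p ->
    covers f2 p -> rows t = relabel p f1 f2 l -> H (vclass theta t).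
  have [q1 q2] := rowsP q.
  have [t tE] := relabel_tree_pair (@lab _) q1 q2.
  by rewrite (tree_pair_relabel tE); apply: main tE.
elim: n p f1 f2 l t => [|n IHn] p f1 f2 l t pn fp1 fp2 tE.
  apply: Hs; rewrite tE; apply: leq_trans (leq_imfset_card _ _ _) _ => //=.
  by apply: leq_trans pn _.
have [p5|p5] := leqP #|` p| 5.
  by apply: Hs; rewrite tE; apply: leq_trans (leq_imfset_card _ _ _) _.
have p1 : (1 < #|` p|)%N by apply: ltn_trans p5.
have [i0 [i1 [xi [i0p i1p fi0 fi1]]]] := exposed_caret fp1 p1.
have [j0 [j1 [xj [j0p j1p fj0 fj1]]]] := exposed_caret fp2 p1.
have i01 := caret_neq fi0 fi1; have j01 := caret_neq fj0 fj1.
(* Six rows are used here: at most four lie in the two exposed carets, and two more carry the caret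
   of the middle factor. *)
have [|a [b [ap bp ab aA bA]]] := @two_more [:: i0; i1; j0; j1] p; first by [].
move: aA bA; rewrite !inE !negb_or.
move=> /and4P[ai0 ai1 aj0 aj1] /and4P[bi0 bi1 bj0 bj1].
have [|w [wp [x1 [y1 [wi0 wi1 wa wb]]]]] := covers_two_carets i0p i1p ap bp.
  by rewrite /= !inE !negb_or i01 ab !(eq_sym i0) !(eq_sym i1) ai0 bi0 ai1 bi1.
have [|w' [wp' [x2 [y2 [wj0 wj1 wa' wb']]]]] := covers_two_carets j0p j1p ap bp.
  by rewrite /= !inE !negb_or j01 ab !(eq_sym j0) !(eq_sym j1) aj0 bj0 aj1 bj1.
pose I r := (r == i0) || (r == i1).
pose l1 r := if I r then 1 else l r.
pose l2 r := if I r then l r else 1.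
have cardD r : r \in p -> (#|` p `\ r| <= n)%N.
  by move=> rp; have := cardfsD1 r p; rewrite rp => E; rewrite E in pn.
have [t1 t1E] := relabel_tree_pair l1 fp1 wp.
have [t2 t2E] := relabel_tree_pair l2 wp wp'.
have [t3 t3E] := relabel_tree_pair (fun=> 1) wp' fp2.
have [t12 t12E] := relabel_tree_pair (fun r => l2 r * l1 r) fp1 wp'.
have H1 : H (vclass theta t1).
  have [||t' t'E ->] := relabel_merge fp1 wp i0p i1p fi0 fi1 wi0 wi1 _ _ t1E.
  - by rewrite /l1 /I eqxx.
  - by rewrite /l1 /I eqxx orbT.
  by apply: IHn t'E; rewrite ?cardD //; apply: covers_merge.
have H2 : H (vclass theta t2).
  have [||t' t'E ->] := relabel_merge wp wp' ap bp wa wb wa' wb' _ _ t2E.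
  - by rewrite /l2 /I (negPf ai0) (negPf ai1).
  - by rewrite /l2 /I (negPf bi0) (negPf bi1).
  by apply: IHn t'E; rewrite ?cardD //; apply: covers_merge.
have H3 : H (vclass theta t3).
  have [//|//|t' t'E ->] :=
    relabel_merge wp' fp2 j0p j1p wj0 wj1 fj0 fj1 _ _ t3E.
  by apply: IHn t'E; rewrite ?cardD //; apply: covers_merge.
have -> : vclass theta t = vclass theta t3 * vclass theta t12 :> V.
  apply: relabel_mul wp' t12E t3E _; rewrite tE; apply: eq_in_imfset => //= r _.
  by rewrite mul1g /l1 /l2; case: ifP => _; rewrite ?mulg1 ?mul1g.
by apply: (HM _ _ H3); rewrite (relabel_mul wp t1E t2E t12E); apply: HM.
Qed.

(** By [covers_size] at most five rows force short words, so all rows lie in one finite set [B].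
    Every tree pair contained in [B] is listed. *)
Lemma finite_generation : exists (n : nat) (gen : 'I_n -> tree_pair gT),
  forall q : tree_pair gT, (#|` rows q| <= 5)%N -> exists i, gen i = q.
Proof.
pose T : finType := (5.-bseq bool * gT)%type.
pose row_of (t : T * T) : row :=
  ((val t.1.1 : seq bool, t.1.2), (val t.2.1 : seq bool, t.2.2)).
pose B : {fset row} := [fset x in [seq row_of t | t <- enum {: T * T}]].
pose L : seq (tree_pair gT) := pmap insub (enum_fset (fpowerset B)).
exists (size L), (fun i => nth (one_tp gT) L i) => q q5.
have [q1 q2] := rowsP q.
have qL : q \in L.
  rewrite mem_pmap_sub /= fpowersetE; apply/fsubsetP => r rq.
  have r1 : (size r.1.1 <= 5)%N.
    by apply: leq_trans (ltnW (covers_size q1 rq)) q5.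
  have r2 : (size r.2.1 <= 5)%N.
    by apply: leq_trans (ltnW (covers_size q2 rq)) q5.
  rewrite inE; apply/mapP; exists ((Bseq r1, r.1.2), (Bseq r2, r.2.2)).
    by rewrite mem_enum.
  by rewrite /row_of /= -!surjective_pairing.
have iL : (index q L < size L)%N by rewrite index_mem.
by exists (Ordinal iL); rewrite /= nth_index.
Qed.

End FiniteGeneration.

(** * Pushdown automata given by a transition relation *)

Section RelationalPda.
Variables (Sigma F Gam : finType) (Q : Type) (dec : F -> Q).
Variable trans : Q -> option Sigma -> Gam -> Q -> seq Gam -> Prop.

Definition opt_cons (a : option Sigma) w := if a is Some c then c :: w else w.

Inductive rstep : Q * seq Sigma * seq Gam -> Q * seq Sigma * seq Gam -> Prop :=
| RStep q a Z q' s w t : trans q a Z q' s ->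
    rstep (q, opt_cons a w, Z :: t) (q', w, s ++ t).

Definition rsteps := clos_refl_trans_1n _ rstep.

Variables (k : nat) (start : F) (bot : Gam) (final : Q -> Prop).
Hypothesis trans_bound : forall q a Z q' s, trans q a Z q' s -> size s <= k.
Hypothesis trans_dec : forall f a Z q' s, trans (dec f) a Z q' s ->
  exists f', dec f' = q'.

Let tr_type : finType := (F * option Sigma * Gam * (F * k.-bseq Gam))%type.
Let tr_ok (t : tr_type) : bool :=
  `[< trans (dec t.1.1.1) t.1.1.2 t.1.2 (dec t.2.1) t.2.2 >].
Let tr_val (t : tr_type) := (t.1, (t.2.1, t.2.2 : seq Gam)).

Definition relational_pda : pda Sigma :=
  @Pda Sigma F Gam start bot [set f | `[< final (dec f) >]]
    [seq tr_val t | t <- enum tr_type & tr_ok t].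

Lemma relational_pda_trans f a Z f' s :
  (f, a, Z, (f', s)) \in pda_trans relational_pda <->
  trans (dec f) a Z (dec f') s.
Proof.
split=> [/mapP[[[[g b] Y] [g' u]]]|tr].
  by rewrite mem_filter => /andP[/asboolP /= ok _] [-> -> -> -> ->].
have sk := trans_bound tr; apply/mapP.
exists (f, a, Z, (f', Bseq sk)) => //.
by rewrite mem_filter mem_enum andbT; apply/asboolP.
Qed.

(** Every code of a state carries all transitions of that state, so a run lifts step by step from
    any chosen code even if [dec] is not injective. *)
Lemma relational_context_free : context_free (fun w => exists q t,
  final q /\ rsteps (dec start, w, [:: bot]) (q, [::], t)).
Proof.
exists relational_pda => w; split=> [[q [t [fq run]]]|[f [t []]]].
  suff [f fE run'] : exists2 f, dec f = q & clos_refl_trans _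
      (@pda_step _ relational_pda) (start, w, [:: bot]) (f, [::], t).
    by exists f, t; rewrite inE; split=> //; apply/asboolP; rewrite fE.
  move: (start) run => f; move: [:: bot] => s.
  move E : (dec f, w, s) => c; move E' : (q, [::], t) => c' run.
  elim: run f w s E E' => [{}c|{}c d e [p a Z p' u v x tr] _ IH] f w s E E'.
    by move: E'; rewrite -E => -[-> -> ->]; exists f => //; apply: rt_refl.
  case: E => fE -> ->; subst p; have [f' f'E] := trans_dec tr; subst p'.
  have [g gE run] := IH f' v (u ++ x) erefl E'.
  exists g => //; apply: rt_trans run; apply: rt_step.
  have /relational_pda_trans := tr.
  by case: a {tr} => [a|]; [apply: PdaRead|apply: PdaEps].
rewrite inE => /asboolP ff run.
exists (dec f), t; split=> //.
suff main c c' : clos_refl_trans_1n _ (@pda_step _ relational_pda) c c' ->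
    rsteps (dec c.1.1, c.1.2, c.2) (dec c'.1.1, c'.1.2, c'.2).
  by apply: (main (_, _, _) (_, _, _)) (clos_rt_rt1n _ _ _ _ run).
elim=> {c c'} [c|c d e st _]; first exact: rt1n_refl.
by case: st => [p a|p] Z p' u v x /relational_pda_trans tr;
  apply: Relation_Operators.rt1n_trans;
  [exact: (RStep (a := Some a))|exact: (RStep (a := None))].
Qed.

End RelationalPda.

(** * The action of a word of generators on binary words *)

Section WordAction.
Variables (gT : finGroupType) (theta : {morphism [set: gT] >-> gT}).
Variables (Sigma : finType) (act : Sigma -> tree_pair gT).
Local Open Scope group_scope.

(** The first letter of [w] acts first, so [w] stands for the product of its letters in reverse
    order. The action is partial: [x] must be long enough for a row to apply at each letter. *)
Fixpoint word_acts (w : seq Sigma) (x y : seq bool) (h : gT) : Prop :=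
  if w is c :: w' then
    exists u g k, [/\ acts theta (act c) x u g, word_acts w' u y k & h = k * g]
  else y = x /\ h = 1.

Lemma push_cat (x y : seq bool) (g : gT) :
  push theta (x ++ y) g = push theta y (push theta x g).
Proof. exact: foldl_cat. Qed.

Lemma acts_cat (p : {fset _}) w v h x : acts theta p w v h ->
  acts theta p (w ++ x) (v ++ x) (push theta x h).
Proof.
move=> [r [y [rp -> -> ->]]]; exists r, (y ++ x).
by rewrite push_cat !catA.
Qed.

Lemma word_acts_cat w x y h z : word_acts w x y h ->
  word_acts w (x ++ z) (y ++ z) (push theta z h).
Proof.
elim: w x h => [|c w IHw] x h /=; first by case=> -> ->; rewrite push1.
move=> [u [g [k [xu uy ->]]]].
exists (u ++ z), (push theta z g), (push theta z k); rewrite pushM.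
by split=> //; [apply: acts_cat|apply: IHw].
Qed.

Lemma word_acts_fun w x y y' h h' : word_acts w x y h -> word_acts w x y' h' ->
  y = y' /\ h = h'.
Proof.
elim: w x h h' => [|c w IHw] x h h' /=; first by move=> [-> ->] [-> ->].
move=> [u [g [k [xu uy ->]]]] [u' [g' [k' [xu' uy' ->]]]].
have [? ?] := acts_fun xu xu'; subst u' g'.
by have [-> ->] := IHw _ _ _ uy uy'.
Qed.

Lemma word_acts_row w c r x y h : r \in rows (act c) ->
  word_acts w (ran_word r ++ x) y h ->
  word_acts (c :: w) (dom_word r ++ x) y (h * push theta x (lab r)).
Proof.
move=> rc wy; exists (ran_word r ++ x), (push theta x (lab r)), h.
by split=> //; exists r, x.
Qed.

Lemma word_acts_cons w c x y h : word_acts (c :: w) x y h ->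
  exists r z k, [/\ r \in rows (act c), x = dom_word r ++ z,
    word_acts w (ran_word r ++ z) y k & h = k * push theta z (lab r)].
Proof.
by move=> [u [g [k [[r [z [rc -> -> ->]]] wy ->]]]]; exists r, z, k.
Qed.

Lemma word_acts_prod w : exists2 p : tree_pair gT,
  vclass theta p = foldr (fun c x => x * vclass theta (act c)) 1 w
    :> thompsonV theta
  & exists n, forall x y h, n <= size x ->
      acts theta p x y h <-> word_acts w x y h.
Proof.
elim: w => [|c w [p pE [n pn]]] /=.
  by exists (one_tp gT) => //; exists 0 => x y h _; apply: acts_one.
have [q qE] :=
  vclass_surj (vclass theta p * vclass theta (act c) : thompsonV theta).
exists q; first by rewrite -pE -qE.
have /thompsonV_mulE[m qm] := esym qE.
have [d cd] := acts_size theta (act c) n.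
exists (maxn m d) => x y h; rewrite geq_max => /andP[mx dx]; rewrite qm //.
by split=> -[u [g [k [xu uy ->]]]]; exists u, g, k; split=> //;
  apply/pn => //; apply: cd xu dx.
Qed.

End WordAction.

(** * The pushdown automaton simulating the action *)

Section Simulation.
Variables (gT : finGroupType) (theta : {morphism [set: gT] >-> gT}).
Variables (Sigma : finType) (act : Sigma -> tree_pair gT) (D : nat).
Local Open Scope group_scope.

Local Arguments push {gT} theta x g : simpl never.
Local Notation push := (push theta).
Local Notation word_acts := (word_acts theta act).

Local Notation stk := ((bool + gT) + option bool)%type.
Local Notation SL b := (inl (inl b) : stk).
Local Notation SK k := (inl (inr k) : stk).
Local Notation SM b := (inr (Some b) : stk).
Local Notation Bot := (inr None : stk).

Definition is_base (Z : stk) := if Z is inr _ then true else false.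

(* [Guess]: the guessed word may still grow. [Match]: it is fixed, and letters
   that stay on the stack cancel with markers. [Diff]: a difference between the
   final and the guessed word has been found. *)
Local Notation Guess := (None : option bool).
Local Notation Match := (Some false : option bool).
Local Notation Diff := (Some true : option bool).

(** [Push m z] still has to push [z], last letter first. [Read m c d g] has read [c] and popped [d]
    in search of a row of [c]; [g] collects the labels met, pushed through the letters popped after
    them. [Fin g] evaluates the label of the stack. *)
Inductive pstate :=
| Push of option bool & seq bool
| Read of option bool & Sigma & seq bool & gT
| Fin of gT
| Acc.

(** [TMatch] and [TRowMatch] guess that the stack is never exhausted again; no label is recorded
    from then on. Nothing tests for the end of the input, but [Fin] and [Acc] read no letter, so an
    accepting run enters them only there. *)
Inductive ptrans : pstate -> option Sigma -> stk -> pstate -> seq stk -> Prop :=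
| TLetter m c Z : ptrans (Push m [::]) (Some c) Z (Read m c [::] 1) [:: Z]
| TPopL m c d g b : size d < D ->
    ptrans (Read m c d g) None (SL b)
      (Read m c (rcons d b) (push [:: b] g)) [::]
| TPopK m c d g k :
    ptrans (Read m c d g) None (SK k) (Read m c d (g * k)) [::]
| TGrow c d g b Z : is_base Z ->
    ptrans (Read Guess c d g) None Z (Read Guess c d g) [:: SL b; SM b; Z]
| TRowGuess c r g Z : r \in rows (act c) ->
    ptrans (Read Guess c (dom_word r) g) None Z
      (Push Guess (ran_word r)) [:: SK (lab r * g); Z]
| TRowMatch c r g Z : r \in rows (act c) -> is_base Z ->
    ptrans (Read Guess c (dom_word r) g) None Z (Push Match (ran_word r)) [:: Z]
| TRow b c r g Z : r \in rows (act c) ->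
    ptrans (Read (Some b) c (dom_word r) g) None Z
      (Push (Some b) (ran_word r)) [:: Z]
| TPush m z b Z : ptrans (Push m (rcons z b)) None Z (Push m z) [:: SL b; Z]
| TMatch z Z : is_base Z -> ptrans (Push Guess z) None Z (Push Match z) [:: Z]
| TCancel z b : ptrans (Push Match (rcons z b)) None (SM b) (Push Match z) [::]
| TDiff z b Z : is_base Z -> Z <> SM b ->
    ptrans (Push Match (rcons z b)) None Z (Push Diff z) [:: Z]
| TAccMatch b : ptrans (Push Match [::]) None (SM b) Acc [:: SM b]
| TAccDiff Z : ptrans (Push Diff [::]) None Z Acc [:: Z]
| TFin Z : ptrans (Push Guess [::]) None Z (Fin 1) [:: Z]
| TFinL g b : ptrans (Fin g) None (SL b) (Fin (push [:: b] g)) [::]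
| TFinK g k : ptrans (Fin g) None (SK k) (Fin (g * k)) [::]
| TFinAcc g Z : is_base Z -> g <> 1 -> ptrans (Fin g) None Z Acc [:: Z].

Fixpoint letters (S : seq stk) : seq bool :=
  match S with
  | inl (inl b) :: S' => b :: letters S'
  | inl (inr _) :: S' => letters S'
  | _ => [::]
  end.

(** This is the label at the lower end of the letters. A label met further down is older, hence
    multiplies on the right. *)
Fixpoint label (S : seq stk) (g : gT) : gT :=
  match S with
  | inl (inl b) :: S' => label S' (push [:: b] g)
  | inl (inr k) :: S' => label S' (g * k)
  | _ => g
  end.

Fixpoint marks (S : seq stk) : seq bool :=
  match S with
  | inl _ :: S' => marks S'
  | inr (Some b) :: S' => rcons (marks S') b
  | _ => [::]
  end.

Fixpoint markers_only (S : seq stk) : bool :=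
  match S with
  | inr (Some _) :: S' => markers_only S'
  | inr None :: _ => true
  | _ => false
  end.

Fixpoint well_formed (S : seq stk) : bool :=
  if S is inl _ :: S' then well_formed S' else markers_only S.

(** * Well-formed stacks and soundness *)

Lemma markers_only_wf S : markers_only S -> well_formed S.
Proof. by case: S => [|[] ]. Qed.

Lemma markers_only_letters S : markers_only S -> letters S = [::].
Proof. by case: S => [|[]]. Qed.

Lemma markers_only_label S g : markers_only S -> label S g = g.
Proof. by case: S => [|[]]. Qed.

Lemma labelM S a b : label S (a * b) = push (letters S) a * label S b.
Proof.
elim: S a b => [|[[c|k]|o] S IHS] a b //=; last by rewrite -IHS mulgA.
by rewrite pushM IHS.
Qed.

(* [x] is the known part of the current word, [w] is unread, and [marks S] is the
   known part of the guessed word; in mode [Guess] both words continue with an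
   unknown [e]. *)
Definition good m w x S g : Prop :=
  match m with
  | None => exists e y k, word_acts w (x ++ e) y k /\
      (y <> marks S ++ e \/ k * push e (label S g) <> 1)
  | Some false => exists y k, word_acts w x y k /\ y <> marks S
  | Some true => exists y k, word_acts w x y k
  end.

Definition sound q w S : Prop :=
  match q with
  | Push m z => good m w (z ++ letters S) S 1
  | Read m c d g => good m (c :: w) (d ++ letters S) S g
  | Fin g => w = [::] /\ label S g <> 1
  | Acc => w = [::]
  end.

(** Well-formedness travels forward and soundness backward: the end of an accepting run is sound,
    and each transition carries a witness back to the configuration before it. *)
Lemma ptrans_sound q a Z q' s w t : ptrans q a Z q' s ->
  well_formed (Z :: t) ->
  well_formed (s ++ t) /\
  (sound q' w (s ++ t) -> sound q (opt_cons a w) (Z :: t)).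
Proof.
case=> {q a Z q' s}.
- by move=> m c Z /= wf; split.
- move=> m c d g b _ /= wf; split=> //.
  by case: m => [[]|]; rewrite /= cat_rcons.
- by move=> m c d g k wf; split=> //; case: m => [[]|].
(* Before the guess, [b] still belongs to the unknown part, so the witness is [b :: e]. *)
- move=> c d g b [//|o] _ /= wf; split=> // -[e [y [k [+ bad]]]].
  rewrite -catA => wy; exists (b :: e), y, k; split; first by rewrite -catA.
  by case: o {wf} bad => [b'|] /=; rewrite ?cat_rcons.
- move=> c r g Z rc wf; rewrite 2!cat_cons cat0s; split; first by case: Z wf.
  move=> [e [y [k [+ bad]]]].
  have [lE kE] : letters (SK (lab r * g) :: Z :: t) = letters (Z :: t) /\
    label (SK (lab r * g) :: Z :: t) 1 = label (Z :: t) (lab r * g).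
    by rewrite /= mul1g.
  rewrite lE -catA => /(word_acts_row rc); rewrite catA => wy.
  exists e, y; eexists; split; first exact: wy.
  case: bad => [|bad]; [by left|right].
  by move: bad; rewrite kE labelM push_cat pushM mulgA.
- move=> c r g [//|o] rc _ /= wf; split=> // -[y [k [wy ne]]].
  exists [::], y, (k * push [::] (lab r)); rewrite !cats0; split; last by left.
  by rewrite -[dom_word r]cats0; apply: word_acts_row => //; move: wy.
- move=> b c r g Z rc wf; split=> //.
  case: b => -[y [k]] => [wy|[wy ne]];
    exists y, (k * push (letters (Z :: t)) (lab r)).
    exact: word_acts_row.
  by split=> //; apply: word_acts_row.
- move=> m z b Z wf; split=> //=; rewrite cat_rcons.
  by case: m => [[]|] //=; rewrite push1.
- move=> z [//|o] _ wf; split=> // -[y [k [wy ne]]].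
  exists [::], y, k; rewrite !cats0; split; last by left.
  by move: wy; rewrite /= cats0.
- move=> z b /= wf; split; first exact: markers_only_wf.
  rewrite (markers_only_letters wf) !cats0 => -[y [k [wy ne]]].
  exists (rcons y b), (push [:: b] k); rewrite -!cats1; split.
    exact: word_acts_cat.
  by rewrite !cats1 => /rcons_inj[].
(* The final word ends in [b], whereas the markers end in another letter or are used up. *)
- move=> z b [//|o] _ ob /= wf; split=> // -[y [k wy]].
  exists (rcons y b), (push [:: b] k); rewrite cats0 -!cats1; split.
    by move: wy; rewrite cats0; apply: word_acts_cat.
  rewrite cats1; case: o ob {wf wy} => [b'|] ob; last by case: y.
  by move=> /rcons_inj[_ bb]; apply: ob; rewrite bb.
- move=> b /= wf; split=> // ->; exists [::], 1; split=> //.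
  by case: marks.
- by move=> Z wf; split=> // /= ->; exists (letters (Z :: t)), 1.
- move=> Z wf; split=> // -[-> bad]; exists [::], (letters (Z :: t)), 1.
  by rewrite !cats0; split=> //; right; rewrite mul1g.
- by [].
- by [].
- by move=> g [//|o] _ g1 wf; split=> //= ->; split.
Qed.

Lemma rsteps_sound q w S t : rsteps ptrans (q, w, S) (Acc, [::], t) ->
  well_formed S -> sound q w S.
Proof.
move E : (q, w, S) => c; move E' : (Acc, [::], t) => c' run.
elim: run q w S E E' => [{}c|{}c d e st _ IH] q w S E E'.
  by move: E'; rewrite -E => -[<- <-].
case: st E IH => p a Z p' s v u tr [-> -> ->] IH wf.
by have [wf' snd] := ptrans_sound v tr wf; apply: snd; apply: IH erefl E' wf'.
Qed.

(** * Completeness: accepting runs for both kinds of witness *)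

Definition accept q w S := exists t, rsteps ptrans (q, w, S) (Acc, [::], t).

Lemma accept_step q a Z q' s w t : ptrans q a Z q' s ->
  accept q' w (s ++ t) -> accept q (opt_cons a w) (Z :: t).
Proof.
move=> tr [u run]; exists u.
exact: Relation_Operators.rt1n_trans (RStep w t tr) run.
Qed.

Lemma accept_push m z w S : well_formed S ->
  accept (Push m [::]) w ([seq SL b | b <- z] ++ S) -> accept (Push m z) w S.
Proof.
elim/last_ind: z S => [//|z b IHz] [//|Z t] wf.
rewrite map_rcons cat_rcons => H.
by apply: accept_step (TPush m z b Z) _; apply: IHz.
Qed.

Lemma accept_skip m c d g S : well_formed S -> letters S = [::] ->
  exists S' g', [/\ markers_only S', marks S' = marks S, g' = label S g
    & forall w, accept (Read m c d g') w S' -> accept (Read m c d g) w S].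
Proof.
elim: S g => [//|[[b|k]|o] S IHS] g //= wf l0; last first.
  by exists (inr o :: S), g; split.
have [S' [g' [wf' mS' gE H]]] := IHS (g * k) wf l0.
exists S', g'; split=> // w /H; exact: (accept_step (TPopK m c d g k)).
Qed.

Lemma accept_pop m c d g b l S : well_formed S -> letters S = b :: l ->
  size d < D ->
  exists S' g', [/\ well_formed S', letters S' = l, marks S' = marks S,
    label S' g' = label S g
    & forall w, accept (Read m c (rcons d b) g') w S' ->
        accept (Read m c d g) w S].
Proof.
elim: S g => [//|[[b'|k]|o] S IHS] g //= wf.
  move=> [-> <-] dD; exists S, (push [:: b] g); split=> // w.
  exact: (accept_step (TPopL m c g b dD)).
move=> lE dD; have [S' [g' [wf' lE' mS' gE H]]] := IHS (g * k) wf lE dD.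
exists S', g'; split=> // w /H; exact: (accept_step (TPopK m c d g k)).
Qed.

(** Here [e] is the part of the guessed word still to come and [e'] what is left of it once [d'] is
    popped. When the letters run out, the rest of [d'] is guessed and remaining labels are popped to
    expose the markers. The disjunction on [letters S] says that either nothing was guessed or no
    letter remains. *)
Lemma accept_read m c d g d' x S e : well_formed S ->
  letters S ++ e = d' ++ x -> m = Guess \/ e = [::] -> size d + size d' <= D ->
  exists S' e' g',
    [/\ well_formed S', letters S' ++ e' = x, marks S' ++ e' = marks S ++ e &
        push e' (label S' g') = push e (label S g)] /\
    [/\ e = [::] -> e' = [::], letters S' = [::] -> markers_only S',
        letters S = d' ++ letters S' \/ letters S' = [::]
      & forall w, accept (Read m c (d ++ d') g') w S' ->
          accept (Read m c d g) w S].
Proof.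
elim: d' d g S e => [|b d' IH] d g S e wf.
  move=> /= xE me _; case lE : (letters S) => [|b l]; last first.
    exists S, e, g; rewrite cats0 lE; by split; split=> //; [rewrite -lE|left].
  have [S' [g' [wf' mS' gE H]]] := accept_skip m c d g wf lE.
  have lE' := markers_only_letters wf'.
  exists S', e, g'; rewrite markers_only_wf // lE' mS' cats0.
  rewrite (markers_only_label _ wf') gE.
  by split; split=> //; [rewrite -xE lE|right|rewrite -gE].
move=> /= xE me dD.
have dD1 : size d < D by apply: leq_trans dD; rewrite -addSnnS leq_addr.
have dD2 : size (rcons d b) + size d' <= D by rewrite size_rcons addSnnS.
case lE : (letters S) xE => [|b' l] /= xE; last first.
  case: xE => bE xE; subst b'.
  have [S1 [g1 [wf1 lE1 mS1 gE1 H1]]] := accept_pop m c g wf lE dD1.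
  have [|S' [e' [g' [[wf' lE' mS' gE] [e0 l0 pl H]]]]] :=
    IH (rcons d b) g1 S1 e wf1 _ me dD2.
    by rewrite lE1.
  exists S', e', g'; rewrite gE mS' mS1 gE1; split; split=> //.
    by case: pl => pl; [left; rewrite -pl lE1|right].
  by move=> w; rewrite -cat_rcons => /H/H1.
case: me => [mE|e0]; last by rewrite e0 in xE.
subst m e; have [S0 [g0 [mo0 mS0 gE0 H0]]] := accept_skip Guess c d g wf lE.
have [|S' [e' [g' [[wf' lE' mS' gE] [e0 l0 pl H]]]]] :=
  IH (rcons d b) (push [:: b] g0) (SM b :: S0) (d' ++ x) mo0 erefl _ dD2.
  by left.
exists S', e', g'; split; split=> //.
- by rewrite mS' /= cat_rcons mS0.
- by rewrite gE /= gE0.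
- by right; case: pl => //=; case: (d') => //= <-.
move=> w; rewrite -cat_rcons => /H acc; apply: H0; move: mo0 acc.
clear -dD1; case: S0 => [//|[//|o] S0] mo0 acc.
apply: accept_step (TGrow c d g0 b (Z := inr o) isT) _.
exact: (accept_step (TPopL Guess c g0 b dD1)).
Qed.

Hypothesis act_bound : forall c r, r \in rows (act c) ->
  size (dom_word r) <= D /\ size (ran_word r) <= D.

Lemma accept_row m c r g w S x e :
  r \in rows (act c) -> well_formed S -> letters S ++ e = dom_word r ++ x ->
  m = Guess \/ e = [::] ->
  exists S' e' g',
    [/\ well_formed S', letters S' ++ e' = x, marks S' ++ e' = marks S ++ e &
        push e' (label S' g') = push e (label S g)] /\
    [/\ e = [::] -> e' = [::], letters S' = [::] -> markers_only S',
        letters S = dom_word r ++ letters S' \/ letters S' = [::]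
      & accept (Read m c (dom_word r) g') w S' ->
          accept (Read m c [::] g) w S].
Proof.
move=> rc wf xE me; have [rD _] := act_bound rc.
have [S' [e' [g' [? [? ? ? H]]]]] := accept_read (d := [::]) c g wf xE me rD.
by exists S', e', g'; split=> //; split=> //; apply: H.
Qed.

Lemma accept_letter m c w S : well_formed S -> accept (Read m c [::] 1) w S ->
  accept (Push m [::]) (c :: w) S.
Proof. by case: S => [//|Z t] _; exact: (accept_step (TLetter m c Z)). Qed.

Lemma letters_cat z S : letters ([seq SL b | b <- z] ++ S) = z ++ letters S.
Proof. by elim: z => //= b z ->. Qed.

Lemma marks_cat z S : marks ([seq SL b | b <- z] ++ S) = marks S.
Proof. by elim: z => //= b z ->. Qed.

Lemma label_cat z S g : label ([seq SL b | b <- z] ++ S) g = label S (push z g).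
Proof. by elim: z g => //= b z IHz g; rewrite IHz. Qed.

Lemma well_formed_cat z S :
  well_formed ([seq SL b | b <- z] ++ S) = well_formed S.
Proof. by elim: z. Qed.

Lemma accept_fin g S : well_formed S -> label S g <> 1 -> accept (Fin g) [::] S.
Proof.
elim: S g => [//|[[b|k]|o] S IHS] g /= wf lg.
- by apply: accept_step (TFinL g b) _; apply: IHS.
- by apply: accept_step (TFinK g k) _; apply: IHS.
- apply: accept_step (TFinAcc (Z := inr o) isT lg) _.
  by exists (inr o :: S); apply: rt1n_refl.
Qed.

(** The run stays in mode [Guess] until the input ends and then evaluates the label. *)
Lemma accept_label w S e y k : well_formed S ->
  word_acts w (letters S ++ e) y k -> k * push e (label S 1) <> 1 ->
  accept (Push Guess [::]) w S.
Proof.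
elim: w S e k => [|c w IHw] S e k wf.
  move=> [_ ->]; rewrite mul1g => bad.
  case: S wf bad => [//|Z t] wf bad; apply: accept_step (TFin Z) _.
  by apply: accept_fin => // l1; apply: bad; rewrite l1 push1.
move=> /word_acts_cons[r [x [k' [rc xE wy ->]]]] bad.
apply: accept_letter => //.
have [|S' [e' [g' [[wf' xE' _ gE] [_ _ _ H]]]]] :=
  accept_row 1 w rc wf xE (m := Guess); first by left.
apply: H; case: S' wf' xE' gE => [//|Z t] wf' xE' gE.
apply: accept_step (TRowGuess g' Z rc) _.
apply: accept_push => //.
set S1 := _ ++ _.
have lE : letters S1 = ran_word r ++ letters (Z :: t) by rewrite letters_cat.
apply: (IHw S1 e' k'); first by rewrite well_formed_cat.
  by rewrite lE -catA xE'.
(* The recorded label lies below the range word, so it is pushed only through the letters that were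
   already there. *)
rewrite label_cat push1 [label _ _]/= -/(label (Z :: t) _) mul1g labelM.
by rewrite pushM -push_cat xE' gE mulgA.
Qed.

(** Only the end of the input has to be reached, and [w] acts on the letters at hand, so no further
    guess is called for. *)
Lemma accept_diff z w S y k : well_formed S ->
  word_acts w (z ++ letters S) y k -> accept (Push Diff z) w S.
Proof.
elim: w z S k => [|c w IHw] z S k wf wy; apply: accept_push => //;
    set S1 := _ ++ S.
  have : well_formed S1 by rewrite well_formed_cat.
  case: S1 => [//|Z t] _; apply: accept_step (TAccDiff Z) _.
  by exists (Z :: t); apply: rt1n_refl.
have wf1 : well_formed S1 by rewrite well_formed_cat.
apply: accept_letter => //.
move: wy; rewrite -letters_cat -/S1 -[letters S1]cats0.
move=> /word_acts_cons[r [x [k' [rc xE wy _]]]].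
have [|S' [e' [g' [[wf' xE' _ _] [e0 _ _ H]]]]] :=
  accept_row 1 w rc wf1 xE (m := Diff); first by right.
apply: H; move: xE'; rewrite e0 // cats0 => xE'.
case: S' wf' xE' => [//|Z t] wf' xE'; apply: accept_step (TRow true g' Z rc) _.
by apply: IHw; rewrite // xE'; exact: wy.
Qed.

(* In mode [Match] a letter is pushed on the markers only if it is popped later;
   a letter that stays forever is compared with the top marker instead. *)
Lemma accept_match z w S y k : well_formed S ->
  word_acts w (z ++ letters S) y k -> y <> marks S ->
  markers_only S \/ (exists x b, letters S = rcons x b /\
    ~ exists y' k', word_acts w (z ++ x) y' k') ->
  accept (Push Match z) w S.
Proof.
pose P w z := forall S y k, well_formed S ->
  word_acts w (z ++ letters S) y k -> y <> marks S ->
  markers_only S \/ (exists x b, letters S = rcons x b /\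
    ~ exists y' k', word_acts w (z ++ x) y' k') ->
  accept (Push Match z) w S.
suff main : forall w z, P w z by move=> wf wy ne; apply: main wf wy ne.
have pushP w' z' b : P w' z' -> P w' (rcons z' b).
  move=> IH [//|Z t] y' k' wf wy ne [mo|[x [b' [lE nx]]]]; last first.
    apply: accept_step (TPush Match z' b Z) _; apply: (IH _ y' k') => //.
      by move: wy; rewrite cat_rcons.
    right; exists (b :: x), b'; split; first by rewrite rcons_cons -lE.
    by move: nx; rewrite cat_rcons.
  have l0 := markers_only_letters mo.
  move: wy; rewrite l0 cats0 => wy.
  (* The letter [b] stays forever exactly when [w'] acts on [z'] alone; it is then the last letter
     of [y'] and is compared with the top marker. *)
  have [[v [h wv]]|nz] := EM (exists y k, word_acts w' z' y k); last first.
    apply: accept_step (TPush Match z' b Z) _; apply: (IH _ y' k') => //.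
      by rewrite [letters _]/= -/(letters (Z :: t)) l0 cats1.
    right; exists [::], b; rewrite cats0; split=> //.
    by rewrite [letters _]/= -/(letters (Z :: t)) l0.
  have yE : y' = rcons v b.
    have := word_acts_cat [:: b] wv; rewrite !cats1.
    by move=> /(word_acts_fun wy)[].
  have [ZE|ZE] := EM (Z = SM b).
    subst Z; apply: accept_step (TCancel z' b) _.
    apply: (IH t v h); first exact: markers_only_wf.
    - by rewrite (markers_only_letters (S := t)) // cats0.
    - by move=> vE; apply: ne; rewrite yE vE.
    - by left.
  case: Z wf mo ne l0 ZE => [//|o] wf mo ne l0 ZE.
  apply: accept_step (TDiff z' (Z := inr o) isT ZE) _.
  by apply: accept_diff wf _; rewrite l0 cats0; exact: wv.
move=> {}w; elim: w => [|c w IHw]; elim/last_ind => [|z' b IHz];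
    try exact: pushP IHz; move=> {}S y' k' wf.
  (* The empty input acts on every word, so no letter can be waiting to be popped: only markers are
     left, and [ne] puts at least one on top. *)
  move=> [-> _] ne [mo|[x [b [lE []]]]]; last by exists x, 1.
  move: ne; rewrite /= markers_only_letters //.
  case: S mo {wf} => [//|[//|[b|]] S] // mo _.
  apply: accept_step (TAccMatch b) _.
  by exists (SM b :: S); apply: rt1n_refl.
move=> + ne perm; rewrite -[letters S]cats0.
move=> /word_acts_cons[r [x [h [rc xE wy _]]]].
apply: accept_letter => //.
have [|S' [e' [g' [[wf' xE' mS' _] [e0 l0 pl H]]]]] :=
  accept_row 1 w rc wf xE (m := Match); first by right.
apply: H; move: xE' mS'; rewrite e0 // !cats0 => xE' mS'.
case: S' wf' xE' mS' l0 pl => [//|Z t] wf' xE' mS' l0 pl.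
apply: accept_step (TRow false g' Z rc) _.
apply: (IHw _ (Z :: t) y' h) => //; rewrite ?mS' ?xE' //.
case/lastP: x xE' {wy xE} => [|x b] xE'; first by left; apply: l0.
(* If [w] could do without the deepest letter now, [c :: w] could have done without it before. *)
right; exists x, b; split=> // -[v [h' wv]].
case: pl => [pl|]; last by rewrite xE'; case: (x).
have := word_acts_row rc wv; rewrite xE' -rcons_cat in pl.
case: perm => [/markers_only_letters|[x1 [b1 [lE nx]]]].
  by rewrite pl; case: (_ ++ _).
move: pl; rewrite lE => /rcons_inj[<- _] wv'.
by apply: nx; do 2 eexists; exact: wv'.
Qed.

(** The last hypothesis says that the letters at hand do not suffice for [w]. The switch to [Match]
    is made after the first row that leaves enough letters for the rest of the input. *)
Lemma accept_guess w S e y k : well_formed S ->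
  word_acts w (letters S ++ e) y k -> y <> marks S ++ e ->
  ~ (exists y' k', word_acts w (letters S) y' k') ->
  accept (Push Guess [::]) w S.
Proof.
elim: w S e k => [|c w IHw] S e k wf.
  by move=> _ _ []; exists (letters S), 1.
move=> /word_acts_cons[r [x [h [rc xE wy _]]]] ne nx.
apply: accept_letter => //.
have [|S' [e' [g' [[wf' xE' mS' _] [_ l0 pl H]]]]] :=
  accept_row 1 w rc wf xE (m := Guess); first by left.
apply: H; case: S' wf' xE' mS' l0 pl => [//|Z t] wf' xE' mS' l0 pl.
have [[v [h' wv]]|nv] :=
    EM (exists v h, word_acts w (ran_word r ++ letters (Z :: t)) v h);
    last first.
  apply: accept_step (TRowGuess g' Z rc) _.
  apply: accept_push => //; set S1 := _ ++ _.
  have lE : letters S1 = ran_word r ++ letters (Z :: t) by rewrite letters_cat.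
  apply: (IHw S1 e' h); first by rewrite well_formed_cat.
  - by rewrite lE -catA xE'.
  - by rewrite marks_cat; move: ne; rewrite -mS'.
  - by rewrite lE.
(* Had a letter remained, nothing would have been guessed for this row, and [c :: w] would act on
   [letters S], against [nx]. *)
have lZ : letters (Z :: t) = [::].
  case: pl => // pl; case: nx; rewrite pl.
  by do 2 eexists; apply: word_acts_row rc wv.
have bZ : is_base Z by move: (l0 lZ); case: (Z).
apply: accept_step (TRowMatch g' rc bZ) _.
apply: (accept_match (y := v) (k := h') (S := Z :: t)) => //;
  last by left; apply: l0.
move=> vE; apply: ne; rewrite -mS' -vE.
have := word_acts_cat e' wv; rewrite -catA xE'.
by move=> /(word_acts_fun wy)[].
Qed.

Lemma accept_iff w : accept (Push Guess [::]) w [:: Bot] <->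
  exists x y h, word_acts w x y h /\ (y <> x \/ h <> 1).
Proof.
split=> [[t /rsteps_sound/(_ isT)[x [y [k [wy bad]]]]]|[x [y [h [wy bad]]]]].
  by exists x, y, k; rewrite [label _ _]/= push1 mulg1 in bad; split.
have [h1|h1] := eqVneq h 1; last first.
  apply: (accept_label (e := x) (k := h) (y := y)) => //.
  by rewrite push1 mulg1; apply/eqP.
have {}bad : y <> x by case: bad.
(* If [w] acts on the empty word, that word replaces [x] as witness: [y] is [y' ++ x] and differs
   from [x], so [y'] is nonempty. *)
have [[y' [k wy']]|ny] := EM (exists y k, word_acts w [::] y k); last first.
  exact: (accept_guess (e := x) (y := y) (k := h)).
apply: accept_step (TMatch [::] (Z := Bot) isT) _.
apply: (accept_match (y := y') (k := k)) => //; last by left.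
move=> /= y0; apply: bad; subst y'.
by have /(word_acts_fun wy)[] := word_acts_cat x wy'.
Qed.

(** * Finiteness of the set of reachable states *)

Definition bounded q :=
  match q with
  | Push _ z => size z <= D
  | Read _ _ d _ => size d <= D
  | _ => true
  end.

Lemma ptrans_bounded q a Z q' s : ptrans q a Z q' s -> bounded q -> bounded q'.
Proof.
case=> //= {q a Z q' s}.
- by move=> m c d g b dD _; rewrite size_rcons.
- by move=> c r g Z /act_bound[].
- by move=> c r g Z /act_bound[].
- by move=> b c r g Z /act_bound[].
- by move=> m z b _; rewrite size_rcons; apply: ltnW.
- by move=> z b; rewrite size_rcons; apply: ltnW.
- by move=> z b Z _ _; rewrite size_rcons; apply: ltnW.
Qed.

Lemma ptrans_size q a Z q' s : ptrans q a Z q' s -> size s <= 3.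
Proof. by case. Qed.

Definition fin_pstate : finType :=
  ((option bool * D.-bseq bool) + (option bool * Sigma * D.-bseq bool * gT)
    + option gT)%type.

Definition decode (f : fin_pstate) : pstate :=
  match f with
  | inl (inl (m, z)) => Push m z
  | inl (inr (m, c, d, g)) => Read m c d g
  | inr (Some g) => Fin g
  | inr None => Acc
  end.

Lemma decode_bounded f : bounded (decode f).
Proof. by case: f => [[[m z]|[[[m c] d] g]]|[g|]] //=; apply: size_bseq. Qed.

Lemma bounded_decode q : bounded q -> exists f, decode f = q.
Proof.
case: q => [m z|m c d g|g|] /= le_D.
- by exists (inl (inl (m, Bseq le_D))).
- by exists (inl (inr (m, c, Bseq le_D, g))).
- by exists (inr (Some g)).
- by exists (inr None).
Qed.

Lemma nontrivial_action_context_free : context_free (fun w =>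
  exists x y h, word_acts w x y h /\ (y <> x \/ h <> 1)).
Proof.
have [||M ML] := @relational_context_free _ fin_pstate stk _ decode ptrans 3
  (inl (inl (Guess, [bseq]))) Bot (eq Acc).
- exact: ptrans_size.
- move=> f a Z q' s tr; apply: bounded_decode.
  exact: ptrans_bounded tr (decode_bounded f).
exists M => w; rewrite -ML -accept_iff; split=> [[t run]|[_ [t [<- run]]]].
  by exists Acc, t.
by exists t.
Qed.

End Simulation.

(** * The co-word problem of the generalized Thompson group *)

Section CoWordProblem.
Variables (gT : finGroupType) (theta : {morphism [set: gT] >-> gT}).
Variables (Sigma : finType) (gen : Sigma -> tree_pair gT).
Local Open Scope group_scope.
Local Notation V := (thompsonV theta).

Definition eval_word (w : seq Sigma) : V :=
  foldr (fun c x => (vclass theta (gen c) : V) * x) 1 w.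

Lemma eval_word_cat v w : eval_word (v ++ w) = eval_word v * eval_word w.
Proof. by elim: v => [|c v IHv] /=; rewrite ?mul1g // IHv mulgA. Qed.

(** In a product the rightmost factor acts first, but the input is read from the left. Inverses
    reverse the order, and a product is 1 exactly when its inverse is. *)
Let act c := inv_tp (gen c).

Lemma eval_word_neq1 w : eval_word w <> 1 <->
  exists x y h, word_acts theta act w x y h /\ (y <> x \/ h <> 1).
Proof.
have [p pE [n pn]] := word_acts_prod theta act w.
have {}pE : vclass theta p = (eval_word w)^-1 :> V.
  rewrite pE; elim: w {pE pn} => [|c w IHw] /=; first by rewrite invg1.
  by rewrite IHw invMg; congr (_ * _); rewrite -thompsonV_invE.
have -> : (eval_word w <> 1) = (~ ev_eq theta p (one_rows gT)).
  rewrite propeqE; split=> ne E; apply: ne.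
    move/(vclass_ev_eq theta p (one_tp gT)): E; rewrite pE => E.
    by apply: invg_inj; rewrite invg1.
  by apply/(vclass_ev_eq theta p (one_tp gT)); rewrite pE E invg1.
split=> [ne|[x [y [h [wy bad]]]] [m pm]].
  apply: contrapT => triv; apply: ne; have [d pd] := acts_total theta p.
  exists (maxn n d) => x y h; rewrite geq_max => /andP[nx dx].
  have {}triv v k : acts theta p x v k -> v = x /\ k = 1.
    move=> /(pn _ _ _ nx) wv; split; apply: contrapT => bad; apply: triv;
      exists x, v, k; split=> //; first by left.
    by right.
  rewrite acts_one; split=> [/triv //|[-> ->]].
  by have [v [k pv]] := pd _ dx; have [vE kE] := triv _ _ pv; subst v k.
(* Padding with zeros reaches both length thresholds and leaves [h] unchanged, since a label is not
   altered on descending to a left child. *)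
pose z := nseq (n + m) false.
have zE : size (x ++ z) = (size x + n + m)%N.
  by rewrite size_cat size_nseq addnA.
have := word_acts_cat z wy; rewrite push_nseq => wz.
have /acts_one[yx h1] : acts theta (one_rows gT) (x ++ z) (y ++ z) h.
  apply/pm; first by rewrite zE leq_addl.
  by apply/pn => //; rewrite zE -addnA addnCA leq_addr.
case: bad; last by apply.
have sz : size y = size x.
  by have /eqP := congr1 size yx; rewrite !size_cat eqn_add2r => /eqP.
by apply; move/eqP: yx; rewrite eqseq_cat // => /andP[/eqP].
Qed.

Lemma coword_context_free : context_free (coword_problem eval_word).
Proof.
pose D := (\max_c \max_(r <- rows (act c))
  maxn (size (dom_word r)) (size (ran_word r)))%N.
have actD c r : r \in rows (act c) ->
    size (dom_word r) <= D /\ size (ran_word r) <= D.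
  move=> rc; apply/andP; rewrite -geq_max; apply: leq_trans (leq_bigmax c).
  exact: (@leq_bigmax_seq _ _ xpredT
    (fun r => maxn (size (dom_word r)) (size (ran_word r)))).
have [M ML] := nontrivial_action_context_free theta actD.
by exists M => w; rewrite -ML; apply: eval_word_neq1.
Qed.

End CoWordProblem.

Theorem theorem4p3 (gT : finGroupType) (theta : {morphism [set: gT] >-> gT}) :
  coCF (thompsonV theta).
Proof.
have [n [gen gen5]] := finite_generation gT.
exists 'I_n, (eval_word theta gen); split; last exact: coword_context_free.
split=> // [v w|]; first exact: eval_word_cat.
apply: small_generate => [x y [v <-] [w <-]|q q5].
  by exists (v ++ w); rewrite eval_word_cat.
by have [i iE] := gen5 q q5; exists [:: i]; rewrite /= mulg1 iE.
Qed.
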